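(* Let $F$ be an absolutely continuous df with pdf $f$, let $k$ be a positive integer, and let $R_k(x)=1-\left(\frac{-\ln F(x)}{1-\ln F(x)}\right)^k$ for $x$ with $F(x)>0$, and $R_k(x)=0$ when $F(x)=0$. Then the following hold. (a) $R_k$ is a df with pdf $r_k(x)=\frac{kf(x)(-\ln F(x))^{k-1}}{F(x)(1-\ln F(x))^{k+1}}$ for $x\in\{y:F(y)>0\}$ (and $0$ elsewhere), $r(R_k)=r(F)$, and $\lim_{x\uparrow r(F)}\frac{1-R_k(x)}{(1-F(x))^k}=1$, so that $R_k$ is tail equivalent to $H_k=1-(1-F)^k$. (b) If $F\in\mathcal{D}_l(\Phi_\alpha)$ for some $\alpha>0$, then $r(R_k)=r(F)=\infty$ and $R_k\in\mathcal{D}_l(\Phi_{k\alpha})$, with $\lim_{n\to\infty}R_k^n(a_nx+b_n)=\Phi_{k\alpha}(x)$, $x\in\mathbb{R}$, for $a_n=F^-\left(1-(1/n)^{1/k}\right)$, $b_n=0$. (c) If $F\in\mathcal{D}_l(\Psi_\alpha)$ for some $\alpha>0$, then $r(R_k)=r(F)<\infty$ and $R_k\in\mathcal{D}_l(\Psi_{k\alpha})$, with $\lim_{n\to\infty}R_k^n(a_nx+b_n)=\Psi_{k\alpha}(x)$, $x\in\mathbb{R}$, for $a_n=r(F)-F^-\left(1-(1/n)^{1/k}\right)$, $b_n=r(F)$. (d) If $F\in\mathcal{D}_l(\Lambda)$ and $v$ is a positive function on $(-\infty,r(F))$ with $\lim_{t\uparrow r(F)}\frac{1-F(t+v(t)x)}{1-F(t)}=e^{-x}$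 for all $x\ge 0$ (so that $\lim_{n\to\infty} F^n(v(\beta_n)x+\beta_n)=\Lambda(x)$ with $\beta_n=F^-(1-1/n)$), then $r(R_k)=r(F)$ and $R_k\in\mathcal{D}_l(\Lambda)$, with $\lim_{n\to\infty}R_k^n(a_nx+b_n)=\Lambda(x)$, $x\in\mathbb{R}$, for $b_n=R_k^-(1-1/n)$, $a_n=v(b_n)/k$.
   Context: df means distribution function on $\mathbb{R}$. For a df $F$: $r(F)=\sup\{x:F(x)<1\}$ and $F^-(y)=\inf\{x:F(x)\ge y\}$. $\Phi_\alpha(x)=\exp(-x^{-\alpha})$ for $x>0$ and $0$ for $x\le 0$; $\Psi_\alpha(x)=\exp(-|x|^{\alpha})$ for $x<0$ and $1$ for $x\ge 0$; $\Lambda(x)=\exp(-e^{-x})$. $F\in\mathcal{D}_l(G)$ means that there exist $a_n>0$, $b_n\in\mathbb{R}$ with $\lim_{n\to\infty}F^n(a_nx+b_n)=G(x)$ at all continuity points $x$ of $G$. Two dfs $A,B$ are tail equivalent if $r(A)=r(B)$ and $\lim_{x\uparrow r(A)}\frac{1-A(x)}{1-B(x)}$ exists in $(0,\infty)$. The convention $0^0=1$ is used, and formulas for norming constants are read for all $n$ large enough that they are defined and $a_n>0$. *)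

(* Defs.v *)
From HB Require Import structures.
From mathcomp Require Import all_boot all_order all_algebra.
From mathcomp Require Import all_classical all_reals all_analysis.

Set Implicit Arguments.
Unset Strict Implicit.
Unset Printing Implicit Defensive.

Import Order.TTheory GRing.Theory Num.Theory.
Import numFieldNormedType.Exports.

Local Open Scope classical_set_scope.
Local Open Scope ring_scope.

Section distribution_functions.
Context {R : realType}.
Implicit Types (F G : R -> R) (f v : R -> R) (a b : nat -> R).

Definition is_df F : Prop :=
  [/\ nondecreasing F, right_continuous F,
      F x @[x --> -oo] --> (0 : R) & F x @[x --> +oo] --> (1 : R)].

(** A df has a pdf iff it is absolutely continuous. *)
Definition has_pdf F f : Prop :=
  [/\ measurable_fun [set: R] f, (forall x, 0 <= f x) &
      forall x, (F x)%:E =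
        (\int[lebesgue_measure]_(t in `]-oo, x]) (f t)%:E)%E].

Definition right_end F : \bar R := ereal_sup [set x%:E | x in [set x | F x < 1]].

(** The real number [F^-(y)] is meaningful only if the set is nonempty and
    bounded below, as it is for a df and [0 < y < 1]; [inf] is [0] otherwise. *)
Definition quantile F (y : R) : R := inf [set x | y <= F x].

(** Approaching [e] from below along the reals. No real lies below [-oo], and
    the right endpoint of a df is never [-oo]. *)
Definition left_nbhs (e : \bar R) : set_system R :=
  match e with
  | r%:E => r^'-
  | +oo%E => +oo
  | -oo%E => [set: set R]
  end.

Definition tail_equivalent F G : Prop :=
  [/\ is_df F, is_df G, right_end F = right_end G &
      exists2 l : R, 0 < l &
        (1 - F x) / (1 - G x) @[x --> left_nbhs (right_end F)] --> l].

Definition Dl F G : Prop :=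
  exists a b, (forall n, 0 < a n) /\
    forall x, {for x, continuous G} ->
      F (a n * x + b n) ^+ n @[n --> \oo] --> G x.

(** Convergence everywhere with norming constants given by formulas that make
    sense only for large [n]; hence [a n > 0] is asserted eventually. *)
Definition converges_normed F G a b : Prop :=
  (\forall n \near \oo, 0 < a n) /\
  forall x, F (a n * x + b n) ^+ n @[n --> \oo] --> G x.

Definition Frechet (alpha x : R) : R :=
  if 0 < x then expR (- (x `^ (- alpha))) else 0.

Definition Weibull (alpha x : R) : R :=
  if x < 0 then expR (- (`|x| `^ alpha)) else 1.

Definition Gumbel (x : R) : R := expR (- expR (- x)).

Definition Rdf (k : nat) F (x : R) : R :=
  if 0 < F x then 1 - (- ln (F x) / (1 - ln (F x))) ^+ k else 0.

Definition Rpdf (k : nat) F f (x : R) : R :=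
  if 0 < F x then
    k%:R * f x * (- ln (F x)) ^+ k.-1 / (F x * (1 - ln (F x)) ^+ k.+1)
  else 0.

Definition Hdf (k : nat) F (x : R) : R := 1 - (1 - F x) ^+ k.

End distribution_functions.

(* Main.v *)
Require Import Defs.
From HB Require Import structures.
From mathcomp Require Import all_boot all_order all_algebra.
From mathcomp Require Import all_classical all_reals all_analysis.
From mathcomp Require Import measurable_realfun ring lra zify.
Import Order.TTheory GRing.Theory Num.Theory.
Import numFieldNormedType.Exports.
Local Open Scope classical_set_scope.
Local Open Scope ring_scope.

(** Write [L = - ln F], so that [1 - R_k = (L / (1 + L)) ^ k] with [L ~ 1 - F]
    near the right endpoint. If [F (u n) ^ m n] converges to [g > 0], where
    [m n] is the integer part of [n ^ (1 / k)], then [m n * L (u n)] tends to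
    [- ln g], hence [n * (1 - R_k (u n))] tends to [(- ln g) ^ k] and
    [R_k (u n) ^ n] to [exp (- (- ln g) ^ k)]. This sends each of the three limit
    laws to its counterpart of index [k], along the constants of [F] at index [m n].

    The constants given by quantiles are compared with those of [F] through
    strict monotonicity of the limit law: [F (u n) ^ m n --> G x0] forces
    [(u n - b (m n)) / a (m n) --> x0]. For the Fréchet law, comparing the indices
    [n] and [n / 2] gives [b n / a n --> 0]; for the Weibull law, comparing [n]
    and [2 n] shows that the right endpoint [r] is finite and
    [(r - b n) / a n --> 0].

    For the density, [x |-> \int_s^x r_k - R_k x] has increments that are
    negligible with respect to those of [F] at every point, hence is constant. *)

(** * Powers and tails *)

Section powers.
Context {R : realType}.
Implicit Types (p s : nat -> R) (m : nat -> nat) (g : R).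

(** The bounds [p * (- ln p) <= 1 - p <= - ln p], multiplied by the weight [w], squeeze either
    quantity by the other, since [p] tends to 1. *)
Lemma cvg_near1_ln {T : Type} {D : set_system T} {FD : Filter D}
    {p w : T -> R} {tau : R} :
    (\forall x \near D, 0 <= w x) -> (\forall x \near D, p x <= 1) ->
    p x @[x --> D] --> (1 : R) ->
  (w x * (1 - p x) @[x --> D] --> tau) <->
  (w x * (- ln (p x)) @[x --> D] --> tau).
Proof.
move=> w0 p1 cp.
have p0 : \forall x \near D, 0 < p x by exact: (cvgr_gt _ cp).
have le1 : \forall x \near D, w x * (1 - p x) <= w x * (- ln (p x)).
  near=> x; have px0 : 0 < p x by near: x.
  apply: ler_wpM2l; first by near: x.
  have := @le_ln1Dx R (p x - 1); rewrite addrCA subrr addr0 => /(_ _).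
  by rewrite ltrBrDl subrr => /(_ px0); lra.
have le2 : \forall x \near D, p x * (w x * (- ln (p x))) <= w x * (1 - p x).
  near=> x; have px0 : 0 < p x by near: x.
  rewrite mulrCA; apply: ler_wpM2l; first by near: x.
  have := @le_ln1Dx R ((p x)^-1 - 1); rewrite addrCA subrr addr0 => /(_ _).
  rewrite ltrBrDl subrr invr_gt0 => /(_ px0); rewrite lnV ?posrE// => h.
  by have := ler_wpM2l (ltW px0) h; rewrite mulrBr mulfV ?gt_eqF// mulr1.
split=> h.
- have h2 : (p x)^-1 * (w x * (1 - p x)) @[x --> D] --> tau.
    rewrite -[tau]mul1r -[X in X * tau]invr1.
    by apply: cvgM h; apply: cvgV.
  apply: squeeze_cvgr h h2; near=> x; have px0 : 0 < p x by near: x.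
  apply/andP; split; first by near: x.
  by rewrite ler_pdivlMl//; near: x.
- have h2 : p x * (w x * (- ln (p x))) @[x --> D] --> tau.
    by rewrite -[tau]mul1r; apply: cvgM.
  by apply: squeeze_cvgr h2 h; near=> x; apply/andP; split; near: x.
Unshelve. all: by end_near. Qed.

(** Taking logarithms, [m * (- ln p)] tends to [- ln g]; division by [m] forces [- ln p] to 0, hence
    [p] to 1, where [- ln p] and [1 - p] are interchangeable. *)
Lemma cvg_pow_tail {m : nat -> nat} {p g} : m n @[n --> \oo] --> \oo ->
    (forall n, 0 <= p n <= 1) -> 0 < g -> p n ^+ m n @[n --> \oo] --> g ->
  (p n @[n --> \oo] --> (1 : R)) /\
  ((m n)%:R * (1 - p n) @[n --> \oo] --> - ln g).
Proof.
move=> cm p01 g0 cpm.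
have mr : (m n)%:R @[n --> \oo] --> (+oo : set_system R) by apply/cvgrnyP.
have m0 : \forall n \near \oo, (0 < m n)%N.
  by near do rewrite -(ltr0n R); apply: (cvgry_gt mr).
have p0 : \forall n \near \oo, 0 < p n.
  have pm0 : \forall n \near \oo, 0 < p n ^+ m n by exact: (cvgr_gt _ cpm).
  near=> n; rewrite lt0r; have /andP[-> _] := p01 n; rewrite andbT.
  have : 0 < p n ^+ m n by near: n.
  (* The value [p n = 0] is excluded once [m n] is positive; at [m n = 0] the power would be 1. *)
  apply: contraTneq => ->; rewrite expr0n gtn_eqF ?ltxx//; near: n; exact: m0.
have mL : (m n)%:R * (- ln (p n)) @[n --> \oo] --> - ln g.
  have : - ln (p n ^+ m n) @[n --> \oo] --> - ln g.
    by apply: cvgN; apply: continuous_cvg => //; exact: continuous_ln.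
  apply: cvg_trans; apply: near_eq_cvg; near=> n.
  rewrite lnXn; last by near: n.
  by rewrite mulrN mulr_natl.
have L0 : - ln (p n) @[n --> \oo] --> 0.
  have : ((m n)%:R)^-1 * ((m n)%:R * (- ln (p n))) @[n --> \oo] --> 0 * - ln g.
    by apply: cvgM => //; apply/gtr0_cvgV0 => //; near do rewrite ltr0n.
  rewrite mul0r; apply: cvg_trans; apply: near_eq_cvg; near=> n.
  by rewrite mulKf// pnatr_eq0 -lt0n; near: n.
have cp : p n @[n --> \oo] --> (1 : R).
  have : expR (- (- ln (p n))) @[n --> \oo] --> expR (- (0 : R)).
    by apply: continuous_cvg; [exact: continuous_expR|exact: cvgN].
  rewrite oppr0 expR0; apply: cvg_trans; apply: near_eq_cvg; near=> n.
  by rewrite opprK lnK// posrE; near: n.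
split=> //; apply/cvg_near1_ln => //; near=> n => //.
by have /andP[] := p01 n.
Unshelve. all: by end_near. Qed.

Lemma cvg_tail_to1 {T : Type} {D : set_system T} {FD : Filter D}
    {p w : T -> R} {tau : R} :
    w x @[x --> D] --> (+oo : set_system R) ->
    w x * (1 - p x) @[x --> D] --> tau ->
  p x @[x --> D] --> (1 : R).
Proof.
move=> cw cwp.
have w0 : \forall x \near D, 0 < w x by exact: (cvgry_gt cw).
have : 1 - (w x)^-1 * (w x * (1 - p x)) @[x --> D] --> 1 - 0 * tau.
  apply: cvgB; first exact: cvg_cst.
  by apply: cvgM => //; apply/gtr0_cvgV0.
rewrite mul0r subr0; apply: cvg_trans; apply: near_eq_cvg; near=> x.
rewrite mulKf; first by rewrite opprB addrCA subrr addr0.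
by rewrite gt_eqF//; near: x.
Unshelve. all: by end_near. Qed.

(** Converse of [cvg_pow_tail]: the tail condition alone makes [p] tend to 1, so that logarithms can
    be taken. *)
Lemma cvg_tail_pow {m : nat -> nat} {p} {tau : R} : m n @[n --> \oo] --> \oo ->
    (forall n, p n <= 1) -> (m n)%:R * (1 - p n) @[n --> \oo] --> tau ->
  p n ^+ m n @[n --> \oo] --> expR (- tau).
Proof.
move=> cm p1 cmp.
have mr : (m n)%:R @[n --> \oo] --> (+oo : set_system R) by apply/cvgrnyP.
have cp : p n @[n --> \oo] --> (1 : R) by exact: (cvg_tail_to1 mr cmp).
have p0 : \forall n \near \oo, 0 < p n by exact: (cvgr_gt _ cp).
have mL : (m n)%:R * (- ln (p n)) @[n --> \oo] --> tau.
  by apply/(cvg_near1_ln _ _ cp) => //; near=> n.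
have : expR (- ((m n)%:R * (- ln (p n)))) @[n --> \oo] --> expR (- tau).
  by apply: continuous_cvg; [exact: continuous_expR|exact: cvgN].
apply: cvg_trans; apply: near_eq_cvg; near=> n.
rewrite mulrN opprK mulr_natl -lnXn ?lnK ?posrE ?exprn_gt0//; near: n; exact: p0.
Unshelve. all: by end_near. Qed.

End powers.

Lemma cvg_exprn {R : realType} {T : Type} {D : set_system T} {FD : Filter D}
    (k : nat) {u : T -> R} {l : R} :
  u x @[x --> D] --> l -> u x ^+ k @[x --> D] --> l ^+ k.
Proof.
move=> ul; elim: k => [|k IH]; first exact: cvg_cst.
under eq_fun do rewrite exprS.
by rewrite exprS; exact: cvgM.
Qed.

(** * Integer parts of k-th roots *)

Section nth_roots.
Context {R : realType}.
Implicit Types (k n : nat) (g : R).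

Definition kroot k n : R := n%:R `^ (k%:R^-1).

Lemma kroot_ge0 k n : 0 <= kroot k n. Proof. exact: powR_ge0. Qed.

Lemma krootX k n : (0 < k)%N -> kroot k n ^+ k = n%:R.
Proof.
move=> k0; rewrite -powR_mulrn ?kroot_ge0// -powRrM mulVf ?powRr1//.
by rewrite pnatr_eq0 -lt0n.
Qed.

Lemma kroot_cvgy k : (0 < k)%N ->
  kroot k n @[n --> \oo] --> (+oo : set_system R).
Proof.
move=> k0; apply/cvgryPge => A.
have cn : n%:R @[n --> \oo] --> (+oo : set_system R) by exact: cvgr_idn.
near=> n; rewrite leNgt; apply/negP => h.
have : n%:R < Num.max A 1 ^+ k.
  rewrite -(krootX k n k0); rewrite ltrXn2r ?kroot_ge0 -?lt0n//.
  by rewrite lt_max h.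
apply/negP; rewrite -leNgt; near: n.
exact: (cvgryPge _).1.
Unshelve. all: by end_near. Qed.

Lemma truncn_cvgny (s : nat -> R) : s n @[n --> \oo] --> (+oo : set_system R) ->
  Num.truncn (s n) @[n --> \oo] --> \oo.
Proof.
move=> sy; apply/(cvgrnyP (R := R)); apply/cvgryPge => A.
near=> n; apply: (@le_trans _ _ (s n - 1)).
  by rewrite lerBrDr; near: n; exact: (cvgryPge _).1.
by rewrite lerBlDr natr1; apply/ltW/truncnS_gt.
Unshelve. all: by end_near. Qed.

Lemma truncn_ratio_cvg (s : nat -> R) :
  s n @[n --> \oo] --> (+oo : set_system R) ->
  (Num.truncn (s n))%:R / s n @[n --> \oo] --> (1 : R).
Proof.
move=> sy.
have s0 : \forall n \near \oo, 0 < s n by exact: (cvgry_gt sy).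
have h : 1 - (s n)^-1 @[n --> \oo] --> (1 : R).
  rewrite -[X in _ --> X]subr0; apply: cvgB; first exact: cvg_cst.
  by apply/gtr0_cvgV0.
apply: (squeeze_cvgr _ h (cvg_cst (1 : R))); near=> n.
have sn : 0 < s n by near: n.
rewrite ler_pdivlMr// ler_pdivrMr// mul1r mulrBl mul1r mulVf ?gt_eqF//.
rewrite lerBlDr natr1 (ltW (truncnS_gt _)) /=.
by rewrite truncn_le ltW.
Unshelve. all: by end_near. Qed.

End nth_roots.

Section Rdf_basics.
Context {R : realType}.
Implicit Types (k : nat) (p : R).

(** The transform acts on the value [p = F x] alone, so its properties reduce to those of the fixed
    function [Rdf k id]. *)
Lemma Rdf_id k (F : R -> R) x : Rdf k F x = Rdf k id (F x).
Proof. by []. Qed.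

Lemma Rdf_le1 k p : p <= 1 -> Rdf k id p <= 1.
Proof.
rewrite /Rdf => p1; case: ifP => // p0.
have L0 : 0 <= - ln p by rewrite oppr_ge0 ln_le0.
by rewrite lerBlDr lerDl exprn_ge0// divr_ge0// addr_ge0.
Qed.

(** With [L = - ln p] and [n = kroot k n ^ k], the product [n * (1 - R_k)] is the [k]-th power of
    [kroot k n * L / (1 + L)], whose limit is that of [m n * L], namely [- ln g]. *)
Lemma Rdf_pow_cvg {k} {m : nat -> nat} {p : nat -> R} {g : R} : (0 < k)%N ->
    m n @[n --> \oo] --> \oo ->
    (m n)%:R / (kroot k n : R) @[n --> \oo] --> (1 : R) ->
    (forall n, 0 <= p n <= 1) -> 0 < g -> p n ^+ m n @[n --> \oo] --> g ->
  Rdf k id (p n) ^+ n @[n --> \oo] --> expR (- (- ln g) ^+ k).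
Proof.
move=> k0 cm ms p01 g0 cp.
have [cp1 cmp] := cvg_pow_tail cm p01 g0 cp.
have p1 n : p n <= 1 by have /andP[] := p01 n.
have p0 : \forall n \near \oo, 0 < p n by exact: (cvgr_gt _ cp1).
have sy := kroot_cvgy (R := R) k k0.
have s0 : \forall n \near \oo, 0 < kroot k n :> R by exact: (cvgry_gt sy).
apply: cvg_tail_pow; [exact: cvg_id|by move=> n; exact: Rdf_le1|].
have mL : (m n)%:R * (- ln (p n)) @[n --> \oo] --> - ln g.
  by apply/(cvg_near1_ln _ _ cp1) => //; near=> n.
have Lc : - ln (p n) @[n --> \oo] --> (0 : R).
  rewrite -oppr0 -ln1; apply: cvgN.
  by apply: continuous_cvg => //; exact: continuous_ln.
have : (((m n)%:R / kroot k n)^-1 * ((m n)%:R * (- ln (p n))) / (1 - ln (p n))) ^+ k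
    @[n --> \oo] --> (1^-1 * (- ln g) / (1 + 0)) ^+ k.
  apply: cvg_exprn.
  apply: cvgM; first by apply: cvgM mL; apply: cvgV.
  by apply: cvgV; [rewrite addr0|apply: cvgD => //; exact: cvg_cst].
rewrite addr0 invr1 mulr1 mul1r; apply: cvg_trans; apply: near_eq_cvg.
have m0 : \forall n \near \oo, 0 < (m n)%:R :> R.
  by apply: cvgry_gt; apply/cvgrnyP.
near=> n; rewrite /Rdf ifT; last by near: n.
have sn : kroot k n != 0 :> R by rewrite gt_eqF//; near: n.
have mn : (m n)%:R != 0 :> R by rewrite gt_eqF//; near: n.
rewrite opprB addrCA subrr addr0 -(krootX k n k0) -exprMn; congr (_ ^+ _).
by rewrite invfM invrK mulrACA mulVf// mul1r !mulrA.
Unshelve. all: by end_near. Qed.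

End Rdf_basics.

(** * Arguments and powers under a limit law *)

Section limit_law.
Context {R : realType} (F G : R -> R) (a b : nat -> R).
Hypothesis F_nd : nondecreasing F.
Hypothesis F01 : forall x, 0 <= F x <= 1.
Hypothesis a_gt0 : forall n, 0 < a n.
Hypothesis FG : forall x, F (a n * x + b n) ^+ n @[n --> \oo] --> G x.

Let FGm (m : nat -> nat) x : m n @[n --> \oo] --> \oo ->
  F (a (m n) * x + b (m n)) ^+ m n @[n --> \oo] --> G x.
Proof. by move=> cm; exact: (cvg_comp _ _ cm (FG x)). Qed.

Let le_pow m x y : x <= y -> F x ^+ m <= F y ^+ m.
Proof.
move=> xy; apply: lerXn2r; last exact: F_nd.
  by rewrite nnegrE; have /andP[] := F01 x.
by rewrite nnegrE; have /andP[] := F01 y.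
Qed.

(** If the argument of [u n] were off by more than [e], monotonicity of [F] would put
    [F (u n) ^ m n] beyond the power at [x0 - e] or [x0 + e], whose limit is separated from
    [G x0]. *)
Lemma law_cvg_arg {m : nat -> nat} {u x0} : m n @[n --> \oo] --> \oo ->
    (forall y, y < x0 -> G y < G x0) -> (forall y, x0 < y -> G x0 < G y) ->
    F (u n) ^+ m n @[n --> \oo] --> G x0 ->
  (u n - b (m n)) / a (m n) @[n --> \oo] --> x0.
Proof.
move=> cm Gl Gr cu; apply/cvgrPdist_le => e e0.
have hl : \forall n \near \oo, F (a (m n) * (x0 - e) + b (m n)) ^+ m n < F (u n) ^+ m n.
  have lt0 : G (x0 - e) < G x0 by apply: Gl; rewrite ltrBlDr ltrDl.
  near=> n; apply: (@lt_trans _ _ ((G (x0 - e) + G x0) / 2)).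
    by near: n; apply: (cvgr_lt _ (FGm m (x0 - e) cm)); lra.
  by near: n; apply: (cvgr_gt _ cu); lra.
have hr : \forall n \near \oo, F (u n) ^+ m n < F (a (m n) * (x0 + e) + b (m n)) ^+ m n.
  have lt0 : G x0 < G (x0 + e) by apply: Gr; rewrite ltrDl.
  near=> n; apply: (@lt_trans _ _ ((G (x0 + e) + G x0) / 2)).
    by near: n; apply: (cvgr_lt _ cu); lra.
  by near: n; apply: (cvgr_gt _ (FGm m (x0 + e) cm)); lra.
near=> n.
have ul : a (m n) * (x0 - e) + b (m n) < u n.
  by rewrite ltNge; apply/negP => /(le_pow (m n)); apply/negP; rewrite -ltNge; near: n.
have ur : u n < a (m n) * (x0 + e) + b (m n).
  by rewrite ltNge; apply/negP => /(le_pow (m n)); apply/negP; rewrite -ltNge; near: n.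
rewrite ler_distlC; apply/andP; split.
  by rewrite ler_pdivlMr// lerBrDr mulrC ltW.
by rewrite ler_pdivrMr// lerBlDr mulrC ltW.
Unshelve. all: by end_near. Qed.

(** Monotonicity of [F] turns convergence at the two points [x0 - d / 2] and [x0 + d / 2] into
    convergence along any arguments tending to [x0]. *)
Lemma law_cvg_pow {m : nat -> nat} {u x0} : m n @[n --> \oo] --> \oo ->
    {for x0, continuous G} ->
    (u n - b (m n)) / a (m n) @[n --> \oo] --> x0 ->
  F (u n) ^+ m n @[n --> \oo] --> G x0.
Proof.
move=> cm Gc cu; apply/cvgrPdist_le => e e0.
have e20 : 0 < e / 2 by rewrite divr_gt0.
have /cvgrPdist_le/(_ _ e20)/nbhs_ballP[d /= d0 Gd] := Gc.
(* Half of the radius [d] keeps both points inside the open ball given by continuity of [G]. *)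
have Gl : `|G x0 - G (x0 - d / 2)| <= e / 2.
  apply: Gd; rewrite /ball/= opprB addrCA subrr addr0 gtr0_norm; lra.
have Gr : `|G x0 - G (x0 + d / 2)| <= e / 2.
  apply: Gd; rewrite /ball/= opprD addrA subrr add0r normrN gtr0_norm; lra.
have d20 : 0 < d / 2 by rewrite divr_gt0.
have cl := FGm m (x0 - d / 2) cm; have cr := FGm m (x0 + d / 2) cm.
near=> n.
have : `|x0 - (u n - b (m n)) / a (m n)| <= d / 2.
  by near: n; exact: (cvgrPdist_le _ _).1 cu _ d20.
rewrite ler_distlC => /andP[].
rewrite ler_pdivlMr// lerBrDr mulrC => /(le_pow (m n)) h1.
rewrite ler_pdivrMr// lerBlDr mulrC => /(le_pow (m n)) h2.
have : `|G (x0 - d / 2) - F (a (m n) * (x0 - d / 2) + b (m n)) ^+ m n| <= e / 2.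
  by near: n; exact: (cvgrPdist_le _ _).1 cl _ e20.
have : `|G (x0 + d / 2) - F (a (m n) * (x0 + d / 2) + b (m n)) ^+ m n| <= e / 2.
  by near: n; exact: (cvgrPdist_le _ _).1 cr _ e20.
move: Gl Gr; rewrite !ler_distlC => /andP[? ?] /andP[? ?] /andP[? ?] /andP[? ?].
by apply/andP; split; lra.
Unshelve. all: by end_near. Qed.

End limit_law.

(** * The three limit laws *)

Section laws.
Context {R : realType}.
Implicit Types (alpha x y : R) (k : nat).

Lemma FrechetE alpha x : 0 < x -> Frechet alpha x = expR (- (x `^ (- alpha))).
Proof. by rewrite /Frechet => ->. Qed.

Lemma FrechetN alpha x : x <= 0 -> Frechet alpha x = 0.
Proof. by rewrite /Frechet ltNge => ->. Qed.

Lemma WeibullE alpha x : x < 0 -> Weibull alpha x = expR (- (`|x| `^ alpha)).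
Proof. by rewrite /Weibull => ->. Qed.

Lemma WeibullP alpha x : 0 <= x -> Weibull alpha x = 1.
Proof. by rewrite /Weibull ltNge => ->. Qed.

Lemma Weibull_gt0 alpha x : 0 < Weibull alpha x.
Proof. by rewrite /Weibull; case: ifP => // _; exact: expR_gt0. Qed.

Lemma lt_powRN alpha x y : 0 < alpha -> 0 < x -> x < y ->
  y `^ (- alpha) < x `^ (- alpha).
Proof.
move=> a0 x0 xy; have y0 := lt_trans x0 xy.
rewrite !powRN ltf_pV2 ?posrE ?powR_gt0//.
by apply: gt0_ltr_powR => //; rewrite nnegrE ltW.
Qed.

(** Strictness persists when [x] lies where the law vanishes, which covers every point to the left
    of a positive [y]. *)
Lemma lt_Frechet alpha x y : 0 < alpha -> 0 < y -> x < y ->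
  Frechet alpha x < Frechet alpha y.
Proof.
move=> a0 y0 xy; rewrite (FrechetE _ _ y0); case: (ltP 0 x) => x0; last first.
  by rewrite FrechetN// expR_gt0.
by rewrite FrechetE// ltr_expR ltrN2; exact: lt_powRN.
Qed.

Lemma lt_Weibull alpha x y : 0 < alpha -> x < 0 -> x < y ->
  Weibull alpha x < Weibull alpha y.
Proof.
move=> a0 x0 xy; rewrite (WeibullE _ _ x0); case: (ltP y 0) => y0; last first.
  rewrite WeibullP// -expR0 ltr_expR oppr_lt0 powR_gt0// normr_gt0.
  by rewrite lt_eqF.
rewrite WeibullE// ltr_expR ltrN2.
by apply: gt0_ltr_powR => //; rewrite ?nnegrE// !ltr0_norm// ltrN2.
Qed.

Lemma lt_Gumbel x y : x < y -> Gumbel x < Gumbel y.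
Proof. by move=> xy; rewrite ltr_expR ltrN2 ltr_expR ltrN2. Qed.

Lemma continuous_powR_gt0 alpha x : 0 < x ->
  {for x, continuous (fun z => z `^ alpha)}.
Proof.
move=> x0.
have powE z : 0 < z -> expR (alpha * ln z) = z `^ alpha.
  by move=> z0; rewrite /powR gt_eqF.
have : expR (alpha * ln z) @[z --> x] --> expR (alpha * ln x).
  apply: continuous_cvg; first exact: continuous_expR.
  by apply: cvgM; [exact: cvg_cst|exact: continuous_ln].
rewrite powE//; apply: cvg_trans; apply: near_eq_cvg; near=> z.
by rewrite powE//; near: z; exact: lt_nbhsr.
Unshelve. all: by end_near. Qed.

(** With [w = z ^ (- alpha)], the bounds [expR (- w) <= 1 / (1 + w) <= 1 / w] leave [z ^ alpha]. *)
Lemma cvg_at_right0_pow alpha : 0 < alpha ->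
  expR (- (z `^ (- alpha))) @[z --> (0 : R)^'+] --> (0 : R).
Proof.
move=> a0; apply: (squeeze_cvgr _ (cvg_cst 0) (powR_cvg0 a0)); near=> z.
have z0 : 0 < z by near: z; exact: nbhs_right_gt.
have za : 0 < z `^ alpha by exact: powR_gt0.
rewrite expR_ge0 /= powRN expRN -[X in _ <= X]invrK.
rewrite lef_pV2 ?posrE ?expR_gt0 ?invr_gt0//.
by apply: le_trans (expR_ge1Dx _); rewrite lerDr.
Unshelve. all: by end_near. Qed.

Lemma Frechet_continuous alpha : 0 < alpha -> continuous (Frechet alpha).
Proof.
move=> a0 x; case: (ltgtP x 0) => x0.
- rewrite /continuous_at FrechetN ?ltW//.
  apply: cvg_near_cst; near=> z.
  by rewrite FrechetN// ltW//; near: z; exact: lt_nbhsl.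
- have : expR (- (z `^ (- alpha))) @[z --> x] --> expR (- (x `^ (- alpha))).
    apply: continuous_cvg; first exact: continuous_expR.
    by apply: cvgN; exact: continuous_powR_gt0.
  rewrite /continuous_at FrechetE//; apply: cvg_trans; apply: near_eq_cvg.
  by near=> z; rewrite FrechetE//; near: z; exact: lt_nbhsr.
- rewrite x0; apply/left_right_continuousP; rewrite FrechetN//; split.
    apply: cvg_near_cst; near=> z.
    by rewrite FrechetN// ltW//; near: z; exact: nbhs_left_lt.
  apply: cvg_trans _ (cvg_at_right0_pow alpha a0); apply: near_eq_cvg; near=> z.
  by rewrite FrechetE//; near: z; exact: nbhs_right_gt.
Unshelve. all: by end_near. Qed.

Lemma Weibull_continuous alpha : 0 < alpha -> continuous (Weibull alpha).
Proof.
move=> a0 x; case: (ltgtP x 0) => x0.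
- have : expR (- ((- z) `^ alpha)) @[z --> x] --> expR (- ((- x) `^ alpha)).
    apply: continuous_cvg; first exact: continuous_expR.
    apply: cvgN; apply: (cvg_comp -%R (fun y => y `^ alpha)).
      by apply: cvgN; exact: cvg_id.
    by apply: continuous_powR_gt0; rewrite oppr_gt0.
  rewrite /continuous_at (WeibullE _ _ x0) (ltr0_norm x0).
  apply: cvg_trans; apply: near_eq_cvg; near=> z.
  have z0 : z < 0 by near: z; exact: lt_nbhsl.
  by rewrite (WeibullE _ _ z0) (ltr0_norm z0).
- rewrite /continuous_at WeibullP ?ltW//.
  apply: cvg_near_cst; near=> z.
  by rewrite WeibullP// ltW//; near: z; exact: lt_nbhsr.
- rewrite x0; apply/left_right_continuousP; rewrite WeibullP//; split; last first.
    apply: cvg_near_cst; near=> z.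
    by rewrite WeibullP//; near: z; exact: nbhs_right_ge.
  have : expR (- ((- z) `^ alpha)) @[z --> (0 : R)^'-] --> expR (- (0 : R)).
    apply: continuous_cvg; first exact: continuous_expR.
    apply: cvgN; apply/cvg_at_leftNP; rewrite oppr0.
    rewrite (_ : _ \o _ = (fun z => z `^ alpha)); first exact: powR_cvg0.
    by apply/funext => z /=; rewrite opprK.
  rewrite oppr0 expR0; apply: cvg_trans; apply: near_eq_cvg; near=> z.
  have z0 : z < 0 by near: z; exact: nbhs_left_lt.
  by rewrite (WeibullE _ _ z0) (ltr0_norm z0).
Unshelve. all: by end_near. Qed.

Lemma Gumbel_continuous : continuous (@Gumbel R).
Proof.
move=> x; apply: continuous_cvg; first exact: continuous_expR.
apply: cvgN; apply: continuous_cvg; first exact: continuous_expR.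
by apply: cvgN; exact: cvg_id.
Qed.

(** Here [- ln (Frechet alpha x)] is [x ^ (- alpha)], whose [k]-th power has index [k * alpha]; this
    identifies the limit found for [R_k]. *)
Lemma Frechet_pow alpha k x : 0 < x ->
  expR (- (- ln (Frechet alpha x)) ^+ k) = Frechet (k%:R * alpha) x.
Proof.
move=> x0; rewrite (FrechetE alpha _ x0) (FrechetE (k%:R * alpha) _ x0).
rewrite expRK opprK -powR_mulrn ?powR_ge0//.
by rewrite -powRrM mulNr mulrC.
Qed.

Lemma Weibull_pow alpha k x : (0 < k)%N ->
  expR (- (- ln (Weibull alpha x)) ^+ k) = Weibull (k%:R * alpha) x.
Proof.
move=> k0; case: (ltP x 0) => x0; last first.
  by rewrite !WeibullP// ln1 oppr0 expr0n gtn_eqF// oppr0 expR0.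
rewrite (WeibullE alpha _ x0) (WeibullE (k%:R * alpha) _ x0).
rewrite expRK opprK -powR_mulrn ?powR_ge0//.
by rewrite -powRrM mulrC.
Qed.

(** Raising to the power [k] rescales the argument by [k], hence the division of [v] by [k] in the
    Gumbel constants. *)
Lemma Gumbel_pow k x : expR (- (- ln (Gumbel x)) ^+ k) = Gumbel (k%:R * x).
Proof. by rewrite /Gumbel expRK opprK -expRM_natl mulrN. Qed.

End laws.

(** * Distribution functions and densities *)

Section df_basics.
Context {R : realType} {F : R -> R}.
Hypothesis dfF : is_df F.

Lemma df_nondecreasing : nondecreasing F. Proof. by case: dfF. Qed.

Lemma df_right_continuous : right_continuous F. Proof. by case: dfF. Qed.

Lemma df_cvgNy : F x @[x --> -oo] --> (0 : R). Proof. by case: dfF. Qed.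

Lemma df_cvgy : F x @[x --> +oo] --> (1 : R). Proof. by case: dfF. Qed.

Lemma df01 x : 0 <= F x <= 1.
Proof.
apply/andP; split; rewrite leNgt; apply/negP => Fx.
- have [y [yx Fy]] := filter_ex (filterI (nbhs_ninfty_le (num_real x))
    (cvgr_gt _ df_cvgNy _ Fx)).
  by have := df_nondecreasing _ _ yx; rewrite leNgt Fy.
- have [y [xy Fy]] := filter_ex (filterI (nbhs_pinfty_ge (num_real x))
    (cvgr_lt _ df_cvgy _ Fx)).
  by have := df_nondecreasing _ _ xy; rewrite leNgt Fy.
Qed.

(** The endpoint is not [-oo] because [F] tends to 0 there. At a finite endpoint [r], right
    continuity forces [F r = 1], since [F r < 1] would extend past [r]. *)
Lemma df_right_endP :
  (right_end F = +oo%E /\ forall z, F z < 1) \/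
  exists2 r : R, right_end F = r%:E & forall z, (F z < 1) = (z < r).
Proof.
have lt1 z : (z%:E < right_end F)%E -> F z < 1.
  move=> /ereal_sup_gt[_ [x /= Fx <-]]; rewrite lte_fin => zx.
  by apply: le_lt_trans Fx; apply: df_nondecreasing; exact: ltW.
case e : (right_end F) => [r| |]; last 2 first.
- by left; split => // z; apply: lt1; rewrite e ltry.
- have [z Fz] := filter_ex (cvgr_lt _ df_cvgNy _ (@ltr01 R)).
  have : (z%:E <= right_end F)%E by apply: ereal_sup_ubound; exists z.
  by rewrite e.
right; exists r => // z; apply/idP/idP => [Fz|zr]; last by apply: lt1; rewrite e lte_fin.
rewrite lt_neqAle -lee_fin -e; apply/andP; split; last first.
  by apply: ereal_sup_ubound; exists z.
apply: contraTneq Fz => ->; rewrite -leNgt.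
rewrite leNgt; apply/negP => Fr.
have [y [ry Fy]] := filter_ex (filterI (nbhs_right_gt r)
  (cvgr_lt _ (df_right_continuous r) _ Fr)).
have : (y%:E <= right_end F)%E by apply: ereal_sup_ubound; exists y.
by rewrite e lee_fin leNgt ry.
Qed.

Global Instance left_nbhs_filter (e : \bar R) : Filter (left_nbhs e).
Proof. by case: e => [r| |] /=; exact: _. Qed.

Lemma near_left_end_lt1 : \forall x \near left_nbhs (right_end F), F x < 1.
Proof.
case: df_right_endP => [[-> h]|[r -> h]] /=; first by near=> x.
by near=> x; rewrite h; near: x; exact: nbhs_left_lt.
Unshelve. all: by end_near. Qed.

Hypothesis F_cont : continuous F.

Lemma cvg_left_end : F x @[x --> left_nbhs (right_end F)] --> (1 : R).
Proof.
case: df_right_endP => [[-> h]|[r -> h]] /=; first exact: df_cvgy.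
have <- : F r = 1.
  apply/eqP; rewrite eq_le; have /andP[_ ->] := df01 r.
  by rewrite leNgt h ltxx.
have := F_cont r; exact: cvg_at_left_filter.
Qed.

(** Any [y] with [F y < 1] lies eventually below [t n], by monotonicity; at a finite endpoint,
    [F (t n) < 1] also keeps [t n] strictly to its left. *)
Lemma cvg_to_left_end (t : nat -> R) : F (t n) @[n --> \oo] --> (1 : R) ->
    (\forall n \near \oo, F (t n) < 1) ->
  t n @[n --> \oo] --> left_nbhs (right_end F).
Proof.
move=> Ft t1.
have gt y : F y < 1 -> \forall n \near \oo, y < t n.
  move=> Fy; near=> n; rewrite ltNge; apply/negP => /df_nondecreasing.
  by rewrite leNgt; apply/negP/negPn; near: n; exact: (cvgr_gt _ Ft).
case: df_right_endP => [[-> h]|[r -> h]] /=.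
  by apply/cvgryPgt => A; exact: gt.
have tr : t n @[n --> \oo] --> r.
  apply/cvgrPdist_le => e e0; have Fre : F (r - e) < 1 by rewrite h ltrBlDr ltrDl.
  apply: filterS2 t1 (gt _ Fre) => n; rewrite h => tn rn.
  by rewrite gtr0_norm ?subr_gt0//; move: rn; lra.
move=> P /tr; apply: filterS2 t1 => n; rewrite h => tn; exact.
Unshelve. all: by end_near. Qed.

(** The intermediate value theorem gives a [c] with [F c = y], and the infimum is at most [c], so
    its value is at most [y]; right continuity excludes a smaller value. *)
Lemma quantileK y : 0 < y < 1 -> F (quantile F y) = y.
Proof.
move=> /andP[y0 y1]; pose S := [set x | y <= F x].
have [l Fl] := filter_ex (cvgr_lt _ df_cvgNy _ y0).
have [u Fu] := filter_ex (cvgr_gt _ df_cvgy _ y1).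
have lu : l <= u.
  by rewrite leNgt; apply/negP => /ltW/df_nondecreasing; rewrite leNgt (lt_trans Fl Fu).
have lbS : has_lbound S.
  exists l => x /= yx; rewrite leNgt; apply/negP => /ltW/df_nondecreasing.
  by rewrite leNgt (lt_le_trans Fl yx).
have S0 : S !=set0 by exists u; exact: ltW.
have [c _ Fc] : exists2 c, c \in `[l, u] & F c = y.
  apply: IVT => //; first by apply: continuous_subspaceT.
  by rewrite ge_min le_max (ltW Fl) (ltW Fu) orbT.
apply/eqP; rewrite eq_le; apply/andP; split.
  by rewrite -[leRHS]Fc; apply: df_nondecreasing; apply: ge_inf => //=; rewrite Fc.
rewrite leNgt; apply/negP => Fq.
have [z [qz Fz]] := filter_ex (filterI (nbhs_right_gt (quantile F y))
  (cvgr_lt _ (df_right_continuous (quantile F y)) _ Fq)).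
have [x Sx xz] := inf_lt S0 qz.
by have := df_nondecreasing _ _ (ltW xz); rewrite leNgt (lt_le_trans Fz Sx).
Qed.

End df_basics.

(** * Increments and continuity of a df with a pdf *)

Section densities.
Context {R : realType} {F f : R -> R}.
Hypothesis dfF : is_df F.
Hypothesis pdfF : has_pdf F f.

Let mu := @lebesgue_measure R.

Let mf (D : set R) : measurable_fun D (fun t => (f t)%:E).
Proof. by apply/measurable_EFinP; apply: measurable_funTS; case: pdfF. Qed.

Let f0 x : (0 <= (f x)%:E)%E.
Proof. by rewrite lee_fin; case: pdfF. Qed.

Lemma integral_pdf x y : x <= y ->
  (\int[mu]_(t in `]x, y]) (f t)%:E)%E = (F y - F x)%:E.
Proof.
move=> xy; have [_ _ FE] := pdfF.
have := FE y.
have -> : [set` `]-oo, y]] = [set` `]-oo, x]] `|` [set` `]x, y]] :> set R.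
  apply/seteqP; split => z /=; rewrite !in_itv /=.
    by case: (leP z x) => zx zy; [left|right].
  by case=> [zx|/andP[]//]; exact: le_trans xy.
rewrite ge0_integral_setU//; last 2 first.
- exact: mf.
- apply/eqP; rewrite -subset0 => z /= []; rewrite !in_itv /= => zx /andP[xz _].
  by move: zx; rewrite leNgt xz.
rewrite -FE EFinB => ->; rewrite addeAC subee ?add0e//.
Qed.

(** Left continuity is monotone convergence of the integrals over []-oo, x - 1 / (n + 1)]], whose
    union []-oo, x[] has the same integral as []-oo, x]]. *)
Lemma pdf_continuous : continuous F.
Proof.
move=> x; apply/left_right_continuousP; split; last exact: df_right_continuous.
have [_ _ FE] := pdfF.
pose y (n : nat) := x - n.+1%:R^-1.
have y_lt n : y n < x by rewrite ltrBlDr ltrDl invr_gt0.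
have yn : y n @[n --> \oo] --> x.
  rewrite -[X in _ --> X]subr0; apply: cvgB; first exact: cvg_cst.
  exact: cvg_harmonic.
have Fyn : F (y n) @[n --> \oo] --> F x.
  suff /fine_cvg : (F (y n))%:E @[n --> \oo] --> (F x)%:E by [].
  rewrite FE -integral_itv_bndo_bndc; last exact: mf.
  have <- : \bigcup_n [set` `]-oo, y n]] = [set` `]-oo, x[].
    apply/seteqP; split => z /=.
      by move=> [n _ /=]; rewrite !in_itv/= => /le_lt_trans; apply.
    rewrite in_itv/= => zx.
    have [n] := filter_ex (cvgr_gt _ yn _ zx).
    by exists n => //=; rewrite in_itv /= ltW.
  under eq_fun do rewrite FE.
  apply: ge0_nondecreasing_set_cvg_integral => //.
  - move=> m n mn; apply/subsetPset => z /=; rewrite !in_itv /= => /le_trans; apply.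
    by rewrite lerD2l lerN2 lef_pV2 ?posrE// ler_nat.
  - by move=> n; exact: mf.
(* Monotonicity of [F] extends the limit along [y n] to all [z] tending to [x] from the left. *)
apply/cvgrPdist_le => e e0.
have [n hn] := filter_ex ((cvgrPdist_le _ _).1 Fyn _ e0).
near=> z; have zx : z < x by near: z; exact: nbhs_left_lt.
rewrite ger0_norm ?subr_ge0; last by apply: (df_nondecreasing dfF); exact: ltW.
have h : F (y n) <= F z.
  by apply: (df_nondecreasing dfF); near: z; apply: nbhs_left_ge.
by move: hn => /(le_trans (ler_norm _)); lra.
Unshelve. all: by end_near. Qed.

End densities.

(** * Centering constants in the domains of attraction *)

(** The limit is [g ^ r]: passing from index [m] to [m'] multiplies the limit of [m * (1 - p)] by
    [r]. *)
Lemma pow_change_index {R : realType} {m m' : nat -> nat} {p : nat -> R} {g r : R} :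
    m n @[n --> \oo] --> \oo -> m' n @[n --> \oo] --> \oo ->
    (m' n)%:R / (m n)%:R @[n --> \oo] --> r ->
    (forall n, 0 <= p n <= 1) -> 0 < g -> p n ^+ m n @[n --> \oo] --> g ->
  p n ^+ m' n @[n --> \oo] --> expR (r * ln g).
Proof.
move=> cm cm' cr p01 g0 cp.
have [_ cmp] := cvg_pow_tail cm p01 g0 cp.
have m0 : \forall n \near \oo, 0 < (m n)%:R :> R.
  by apply: cvgry_gt; apply/cvgrnyP.
rewrite -[r * _]opprK -mulrN; apply: cvg_tail_pow => //.
  by move=> n; have /andP[] := p01 n.
have : (m' n)%:R / (m n)%:R * ((m n)%:R * (1 - p n)) @[n --> \oo] --> r * (- ln g).
  exact: cvgM.
apply: cvg_trans; apply: near_eq_cvg; near=> n.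
by rewrite mulrA divfK// gt_eqF//; near: n.
Unshelve. all: by end_near. Qed.

(** Each halving of the index contracts by [rho] up to an error [d], and for large [n] many halvings
    are possible before a fixed threshold is reached. *)
Lemma half_contraction_cvg0 {R : realType} (e : nat -> R) (rho : R) :
    (forall n, 0 <= e n) -> 0 <= rho < 1 ->
    (forall d, 0 < d -> \forall n \near \oo, e n <= rho * e n./2 + d) ->
  e n @[n --> \oo] --> (0 : R).
Proof.
move=> e0 /andP[rho0 rho1] he; apply/cvgrPdist_le => eps eps0.
have h2 : 0 < eps / 2 by rewrite divr_gt0.
(* This error makes [eps / 2] the fixed point of [z |-> rho * z + d], so the excess over [eps / 2]
   shrinks by [rho] at each step. *)
have dpos : 0 < (1 - rho) * (eps / 2) by rewrite mulr_gt0// subr_gt0.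
have [N _ hN] := he _ dpos.
pose M := \sum_(i < N.+1) e i.
have M0 : 0 <= M by apply: sumr_ge0.
have step n c : (N < n)%N -> e n./2 <= eps / 2 + c -> e n <= eps / 2 + rho * c.
  move=> Nn hc; apply: (le_trans (hN n (ltnW Nn))).
  apply: (@le_trans _ _ (rho * (eps / 2 + c) + (1 - rho) * (eps / 2))).
    by rewrite lerD2r ler_wpM2l.
  by lra.
(* From [2 ^ j * N.+1] on, [j] halvings stay above [N]; the case [j = 0] bounds all [n] by strong
   induction. *)
have bnd j : forall n, (2 ^ j * N.+1 <= n)%N -> e n <= eps / 2 + rho ^+ j * M.
  elim: j => [|j IH] n hn; last first.
    rewrite exprS -mulrA; apply: step; last first.
      apply: IH; rewrite -[leqLHS]doubleK; apply: half_leq.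
      by rewrite -mul2n mulnA -expnS.
    by apply: leq_trans hn; rewrite leq_pmull// expn_gt0.
  rewrite expr0 mul1r {hn}; elim/ltn_ind: n => n IH.
  have [nN|Nn] := leqP n N.
    rewrite -[leLHS]add0r; apply: lerD; first exact: ltW.
    rewrite /M (bigD1 (inord n)) //= inordK// lerDl.
    by apply: sumr_ge0.
  apply: (@le_trans _ _ (eps / 2 + rho * M)).
    apply: step => //; apply: IH; rewrite ltn_half_double -addnn.
    by rewrite -[ltnLHS]addn0 ltn_add2l (leq_trans _ Nn).
  by rewrite lerD2l ler_piMl// ltW.
have [j hj] : exists j, rho ^+ j * M <= eps / 2.
  have : rho ^+ j * M @[j --> \oo] --> 0 * M.
    by apply: cvgM; [apply: cvg_expr; rewrite ger0_norm|exact: cvg_cst].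
  rewrite mul0r => h; have /= [j _ hj] := (cvgrPdist_le _ _).1 h _ h2.
  exists j; have := hj j (leqnn _).
  by rewrite sub0r normrN ger0_norm// mulr_ge0// exprn_ge0.
exists (2 ^ j * N.+1)%N => //= n /= hn.
rewrite sub0r normrN ger0_norm//; apply: le_trans (bnd j n hn) _; lra.
Qed.

Lemma half_cvgny : n./2 @[n --> \oo] --> \oo.
Proof.
apply/cvgnyPge => A; exists (A.*2)%N => //= n /= hn.
by rewrite -[leqLHS]doubleK half_leq.
Qed.

Lemma natr_half_ratio {R : realType} : n%:R / (n./2)%:R @[n --> \oo] --> (2 : R).
Proof.
have hy : (n./2)%:R @[n --> \oo] --> (+oo : set_system R).
  by apply/cvgrnyP; exact: half_cvgny.
have h0 : \forall n \near \oo, 0 < (n./2)%:R :> R by exact: (cvgry_gt hy).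
have h1 : 2 + ((n./2)%:R)^-1 @[n --> \oo] --> (2 : R).
  rewrite -[X in _ --> X]addr0; apply: cvgD; first exact: cvg_cst.
  by apply/gtr0_cvgV0.
apply: (squeeze_cvgr _ (cvg_cst (2 : R)) h1); near=> n.
have n2 : 0 < (n./2)%:R :> R by near: n.
rewrite ler_pdivlMr// ler_pdivrMr// (mulrDl _ _^-1) mulVf ?gt_eqF// -natrM natr1 !ler_nat.
by have := odd_double_half n; case: (odd n); lia.
Unshelve. all: by end_near. Qed.

Lemma powR2_invN_lt1 {R : realType} (alpha : R) : 0 < alpha ->
  2 `^ (- alpha^-1) < 1 :> R.
Proof.
move=> alpha_gt0; rewrite powRN invf_lt1 ?powR_gt0//.
have : (1 : R) `^ alpha^-1 < 2 `^ alpha^-1.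
  by apply: gt0_ltr_powR; rewrite ?nnegrE ?invr_gt0// ltr1n.
by rewrite powR1.
Qed.

Section attraction.
Context {R : realType} {F : R -> R} {a b : nat -> R}.
Hypothesis F_nd : nondecreasing F.
Hypothesis F01 : forall x, 0 <= F x <= 1.
Hypothesis a_gt0 : forall n, 0 < a n.

Section Frechet_attraction.
Variable alpha : R.
Hypothesis alpha_gt0 : 0 < alpha.
Hypothesis FG :
  forall x, F (a n * x + b n) ^+ n @[n --> \oo] --> Frechet alpha x.

(** The scale with [c ^ (- alpha) = 2]: for positive [x], [Frechet alpha (c * x)] is the square of
    [Frechet alpha x]. *)
Let c : R := 2 `^ (- alpha^-1).

Let c_gt0 : 0 < c. Proof. exact: powR_gt0. Qed.

Let c_lt1 : c < 1. Proof. exact: powR2_invN_lt1. Qed.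

(** Since [n] is about twice [n./2], the points of index [n./2] produce the square of
    [Frechet alpha x] at index [n]; strict monotonicity then identifies their limiting argument as
    [c * x]. *)
Let half_arg x : 0 < x ->
  (a n./2 * x + b n./2 - b n) / a n @[n --> \oo] --> c * x.
Proof.
move=> x0; have cx0 : 0 < c * x by rewrite mulr_gt0.
apply: (law_cvg_arg F (Frechet alpha) a b F_nd F01 a_gt0 FG cvg_id).
- by move=> y; exact: lt_Frechet.
- by move=> y xy; apply: lt_Frechet => //; exact: lt_trans xy.
have h : F (a n./2 * x + b n./2) ^+ n./2 @[n --> \oo] --> Frechet alpha x.
  exact: (cvg_comp _ _ half_cvgny (FG x)).
have G0 : 0 < Frechet alpha x by rewrite FrechetE// expR_gt0.
have := pow_change_index half_cvgny cvg_id natr_half_ratio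
  (fun n => F01 (a n./2 * x + b n./2)) G0 h.
rewrite !FrechetE// expRK mulrN powRM ?ltW// /c -powRrM mulrNN mulVf ?gt_eqF//.
by rewrite powRr1.
Qed.

(** The points 1 and 2 yield [a n./2 / a n --> c] and [(b n - b n./2) / a n --> 0]. Hence, up to a
    vanishing error, the absolute value of [b n / a n] is at most a constant below 1 times the one
    at [n./2]. *)
Lemma Frechet_centering : b n / a n @[n --> \oo] --> (0 : R).
Proof.
have h1 := half_arg 1 ltr01.
have h2 := half_arg 2 (ltr0n _ 2).
have ha : a n./2 / a n @[n --> \oo] --> c.
  have : (a n./2 * 2 + b n./2 - b n) / a n - (a n./2 * 1 + b n./2 - b n) / a n
    @[n --> \oo] --> c * 2 - c * 1 by exact: cvgB.
  rewrite -mulrBr (_ : 2 - 1 = 1 :> R) ?mulr1; last by lra.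
  apply: cvg_trans; apply: near_eq_cvg; near=> n.
  by rewrite -mulrBl; congr (_ / _); lra.
have hb : (b n - b n./2) / a n @[n --> \oo] --> (0 : R).
  have : a n./2 / a n - (a n./2 * 1 + b n./2 - b n) / a n @[n --> \oo] --> c - c * 1.
    exact: cvgB.
  rewrite mulr1 subrr; apply: cvg_trans; apply: near_eq_cvg; near=> n.
  by rewrite -mulrBl; congr (_ / _); lra.
apply/norm_cvg0P; apply: (@half_contraction_cvg0 _ _ ((1 + c) / 2)).
- by move=> n; exact: normr_ge0.
- by move: c_gt0 c_lt1 => ? ?; apply/andP; split; lra.
move=> d d0; near=> n.
have -> : b n / a n = (b n./2 / a n./2) * (a n./2 / a n) + (b n - b n./2) / a n.
  by rewrite mulrA divfK ?gt_eqF// -mulrDl addrC subrK.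
apply: le_trans (ler_normD _ _) _; apply: lerD; last first.
  near: n; have /cvgrPdist_le/(_ _ d0) := hb.
  by apply: filterS => n; rewrite sub0r normrN.
rewrite normrM mulrC; apply: ler_wpM2r => //.
rewrite ger0_norm ?divr_ge0 ?ltW//.
by near: n; apply: (cvgr_lt _ ha); move: c_lt1; lra.
Unshelve. all: by end_near. Qed.

(** If [F y = 1], pick [y0 > 0] with [F y0 < 1]. As [F (a n)] tends to 1, eventually [a n > y0], so
    [a n * (y / y0) > y] and [F] is 1 there, against the limit [Frechet alpha (y / y0) < 1]. *)
Lemma Frechet_lt1 y : right_continuous F -> F y < 1.
Proof.
move=> Frc.
have scaled x : F (a n * x) ^+ n @[n --> \oo] --> Frechet alpha x.
  apply: (law_cvg_pow F (Frechet alpha) a b F_nd F01 a_gt0 FG cvg_id).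
    exact: Frechet_continuous.
  rewrite -[X in _ --> X]subr0; have : x - b n / a n @[n --> \oo] --> x - 0.
    by apply: cvgB; [exact: cvg_cst|exact: Frechet_centering].
  apply: cvg_trans; apply: near_eq_cvg; near=> n.
  by rewrite mulrBl mulrAC divff ?mul1r// gt_eqF.
have F0 : F 0 < 1.
  rewrite lt_neqAle; have /andP[_ ->] := F01 0; rewrite andbT.
  apply/negP => /eqP F01'.
  (* At 0 the scaled points are constant, so [F 0 = 1] would give powers equal to 1 instead of
     tending to 0. *)
  have h0 := scaled 0; rewrite FrechetN// in h0.
  have [n] := filter_ex (cvgr_lt _ h0 _ ltr01).
  by rewrite mulr0 F01' expr1n ltxx.
have [y0 y0_gt0 Fy0] : exists2 y0, 0 < y0 & F y0 < 1.
  have : \forall y \near (0 : R)^'+, 0 < y /\ F y < 1.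
    apply: filterI; first exact: nbhs_right_gt.
    exact: (cvgr_lt _ (Frc 0)).
  by move/filter_ex => [z [? ?]]; exists z.
have F1 : F (a n) @[n --> \oo] --> (1 : R).
  have := scaled 1; under eq_fun do rewrite mulr1.
  move=> h; have [] // := cvg_pow_tail cvg_id (fun n => F01 (a n)) _ h.
  by rewrite FrechetE// expR_gt0.
rewrite lt_neqAle; have /andP[_ ->] := F01 y; rewrite andbT.
apply/negP => /eqP Fy.
have y_gt0 : 0 < y.
  by rewrite ltNge; apply/negP => /F_nd; rewrite Fy leNgt F0.
have x0 : 0 < y / y0 by rewrite divr_gt0.
have G1 : Frechet alpha (y / y0) < 1.
  by rewrite FrechetE// -expR0 ltr_expR oppr_lt0 powR_gt0.
have [n [h1 h2]] : exists n, F (a n * (y / y0)) ^+ n < 1 /\ F y0 < F (a n).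
  suff : \forall n \near \oo, F (a n * (y / y0)) ^+ n < 1 /\ F y0 < F (a n).
    by move/filter_ex => [n ?]; exists n.
  by apply: filterI; [apply: (cvgr_lt _ (scaled _))|apply: (cvgr_gt _ F1)].
have : y0 < a n by rewrite ltNge; apply/negP => /F_nd; rewrite leNgt h2.
rewrite -(ltr_pM2r x0) mulrCA divff ?gt_eqF// mulr1 => /ltW/F_nd.
rewrite Fy => h3; move: h1; suff -> : F (a n * (y / y0)) = 1 by rewrite expr1n ltxx.
by apply/eqP; rewrite eq_le h3 andbT; have /andP[] := F01 (a n * (y / y0)).
Unshelve. all: by end_near. Qed.

End Frechet_attraction.

(** * Centering at a finite right endpoint *)

Section Weibull_attraction.
Variable alpha : R.
Hypothesis alpha_gt0 : 0 < alpha.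
Hypothesis FG :
  forall x, F (a n * x + b n) ^+ n @[n --> \oo] --> Weibull alpha x.

(** The scale with [c ^ alpha = 1 / 2]: for negative [x], [Weibull alpha (c * x)] is the square root
    of [Weibull alpha x]. *)
Let c : R := 2 `^ (- alpha^-1).

Let c_gt0 : 0 < c. Proof. exact: powR_gt0. Qed.

Let c_lt1 : c < 1. Proof. exact: powR2_invN_lt1. Qed.

(** Reading the points of index [2 n] at index [n] halves the exponent, which turns the limit into
    its square root. *)
Let double_arg x : x < 0 ->
  (a n.*2 * x + b n.*2 - b n) / a n @[n --> \oo] --> c * x.
Proof.
move=> x0; have cx0 : c * x < 0 by rewrite pmulr_rlt0.
have dny : n.*2 @[n --> \oo] --> \oo.
  apply/cvgnyPge => A; exists A => //= n /= hn.
  by apply: leq_trans hn _; rewrite -addnn leq_addr.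
apply: (law_cvg_arg F (Weibull alpha) a b F_nd F01 a_gt0 FG cvg_id).
- by move=> y yc; apply: lt_Weibull => //; exact: lt_trans cx0.
- by move=> y xy; exact: lt_Weibull.
have h : F (a n.*2 * x + b n.*2) ^+ n.*2 @[n --> \oo] --> Weibull alpha x.
  exact: (cvg_comp _ _ dny (FG x)).
have ratio : n%:R / (n.*2)%:R @[n --> \oo] --> (2^-1 : R).
  apply: cvg_near_cst; exists 1%N => //= n /= n0.
  by rewrite -muln2 natrM invfM mulrA divff ?mul1r// pnatr_eq0 -lt0n.
have := pow_change_index dny cvg_id ratio
  (fun n => F01 (a n.*2 * x + b n.*2)) (Weibull_gt0 alpha x) h.
rewrite !WeibullE// expRK mulrN normrM (gtr0_norm c_gt0) powRM ?(ltW c_gt0)//.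
by rewrite /c -powRrM mulNr mulVf ?gt_eqF// powR_inv1.
Qed.

Let double_cvg : (a n.*2 / a n @[n --> \oo] --> c) /\
  ((b n.*2 - b n) / a n @[n --> \oo] --> (0 : R)).
Proof.
have N10 : -1 < 0 :> R by rewrite ltrN10.
have N20 : -2 < 0 :> R by rewrite oppr_lt0.
have h1 := double_arg (-1) N10.
have h2 := double_arg (-2) N20.
split.
  have : (a n.*2 * -1 + b n.*2 - b n) / a n - (a n.*2 * -2 + b n.*2 - b n) / a n
    @[n --> \oo] --> c * -1 - c * -2 by exact: cvgB.
  rewrite -mulrBr (_ : -1 - -2 = 1 :> R) ?mulr1; last by lra.
  apply: cvg_trans; apply: near_eq_cvg; near=> n.
  by rewrite -mulrBl; congr (_ / _); lra.
have : (a n.*2 * -1 + b n.*2 - b n) / a n *+ 2 - (a n.*2 * -2 + b n.*2 - b n) / a n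
  @[n --> \oo] --> (c * -1) *+ 2 - c * -2 by apply: cvgB => //; exact: cvgMn.
rewrite (_ : _ - _ = 0 :> R); last by lra.
apply: cvg_trans; apply: near_eq_cvg; near=> n.
by rewrite -mulrnAl -mulrBl; congr (_ / _); lra.
Unshelve. all: by end_near. Qed.

(** For large [n], [b n + eps * a n] does not increase when [n] doubles, so it bounds
    [b (2 ^ j * n)] for all [j]. Were [F] below 1 at this point, its powers of exponent [2 ^ j * n]
    would tend to 0, while those at [b (2 ^ j * n)] tend to [Weibull alpha 0 = 1]. *)
Let eventually1 eps : 0 < eps -> \forall n \near \oo, F (b n + eps * a n) = 1.
Proof.
move=> e0; have [ca cb] := double_cvg.
have rho1 : (1 + c) / 2 < 1 by move: c_lt1; lra.
have d0 : 0 < eps * (1 - (1 + c) / 2) by rewrite mulr_gt0// subr_gt0.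
(* With [rho = (1 + c) / 2], a doubling lowers [eps * a n] by at least [eps * (1 - rho) * a n],
   which exceeds the increase of [b]. *)
have hstep : \forall n \near \oo,
    b n.*2 + eps * a n.*2 <= b n + eps * a n.
  near=> n; have an := a_gt0 n.
  have : a n.*2 / a n < (1 + c) / 2.
    by near: n; apply: (cvgr_lt _ ca); move: c_lt1; lra.
  rewrite ltr_pdivrMr// => /ltW /(ler_wpM2l (ltW e0)) h1.
  have : (b n.*2 - b n) / a n < eps * (1 - (1 + c) / 2).
    by near: n; exact: (cvgr_lt _ cb).
  by rewrite ltr_pdivrMr// => h2; move: h1 h2; lra.
have [N _ hN] := hstep.
have le_b j : forall n, (N <= n)%N -> b (2 ^ j * n)%N <= b n + eps * a n.
  elim: j => [|j IH] n Nn; first by rewrite expn0 mul1n lerDl mulr_ge0// ltW.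
  rewrite expnSr -mulnA mul2n; apply: le_trans (hN n Nn).
  by apply: IH; apply: leq_trans Nn _; rewrite -addnn leq_addr.
(* Starting at [N.+1] keeps [n] positive, so that [2 ^ j * n] tends to infinity with [j]. *)
exists N.+1 => //= n /= Nn.
have /andP[F0 F1] := F01 (b n + eps * a n).
apply/eqP; rewrite eq_le F1 /= leNgt; apply/negP => F_lt1.
have jy : (2 ^ j * n)%N @[j --> \oo] --> \oo.
  apply/cvgnyPge => A; exists A => //= j /= hj; apply: (leq_trans hj).
  apply: (@leq_trans (2 ^ j)%N); first by rewrite ltnW// ltn_expl.
  by rewrite leq_pmulr// (leq_trans _ Nn).
have c1 : F (b (2 ^ j * n)%N) ^+ (2 ^ j * n) @[j --> \oo] --> (1 : R).
  have := cvg_comp _ _ jy (FG 0); rewrite WeibullP//.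
  by under eq_fun do rewrite /= mulr0 add0r.
have c0 : F (b n + eps * a n) ^+ (2 ^ j * n) @[j --> \oo] --> (0 : R).
  by apply: (cvg_comp _ _ jy); apply: cvg_expr; rewrite ger0_norm.
have h12 : (2^-1 : R) < 1 by rewrite invf_lt1// ltr1n.
have h02 : 0 < (2^-1 : R) by rewrite invr_gt0.
have [j [h1 h2]] := filter_ex (filterI (cvgr_gt _ c1 _ h12) (cvgr_lt _ c0 _ h02)).
have : F (b (2 ^ j * n)%N) ^+ (2 ^ j * n) <= F (b n + eps * a n) ^+ (2 ^ j * n).
  rewrite lerXn2r ?nnegrE//; first by have /andP[] := F01 (b (2 ^ j * n)%N).
  by apply: F_nd; apply: le_b; exact: ltnW.
by rewrite leNgt (lt_trans h2 h1).
Unshelve. all: by end_near. Qed.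

Let eventually_lt1 eps : 0 < eps -> \forall n \near \oo, F (b n - eps * a n) < 1.
Proof.
move=> e0; have Ne : - eps < 0 by rewrite oppr_lt0.
have G1 : Weibull alpha (- eps) < 1.
  by rewrite -(WeibullP alpha 0)//; exact: lt_Weibull.
have : \forall n \near \oo, F (a n * - eps + b n) ^+ n < 1.
  by apply: (cvgr_lt _ (FG (- eps))).
apply: filterS => n; rewrite mulrN mulrC addrC => h; rewrite lt_neqAle.
have /andP[_ ->] := F01 (b n - eps * a n); rewrite andbT.
by apply: contraTneq h => ->; rewrite expr1n ltxx.
Qed.

(** For every [eps > 0] the endpoint is eventually within [eps * a n] of [b n]: [F] is 1 at
    [b n + eps * a n] and below 1 at [b n - eps * a n]. *)
Lemma Weibull_right_end : (right_end F < +oo)%E /\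
  ((fine (right_end F) - b n) / a n @[n --> \oo] --> (0 : R)).
Proof.
have ub eps : 0 < eps ->
    \forall n \near \oo, (right_end F <= (b n + eps * a n)%:E)%E.
  move=> e0; have := eventually1 _ e0; apply: filterS => n Fn.
  apply: ge_ereal_sup => _ [x /= Fx <-]; rewrite lee_fin leNgt; apply/negP.
  by move=> /ltW/F_nd; rewrite Fn leNgt Fx.
have lb eps : 0 < eps ->
    \forall n \near \oo, ((b n - eps * a n)%:E <= right_end F)%E.
  move=> e0; have := eventually_lt1 _ e0; apply: filterS => n Fn.
  by apply: ereal_sup_ubound; exists (b n - eps * a n).
have [n [rlt rgt]] := filter_ex (filterI (ub 1 ltr01) (lb 1 ltr01)).
have roo : (right_end F < +oo)%E by apply: le_lt_trans rlt _; rewrite ltry.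
split => //.
have rfin : right_end F \is a fin_num.
  by rewrite fin_real// roo andbT (lt_le_trans _ rgt)// ltNyr.
apply/cvgrPdist_le => eps e0.
apply: filterS2 (ub _ e0) (lb _ e0) => i.
rewrite -(fineK rfin) !lee_fin /= => h1 h2.
rewrite sub0r normrN normrM normfV (gtr0_norm (a_gt0 i)) ler_pdivrMr//.
by rewrite ler_norml; apply/andP; split; lra.
Qed.

End Weibull_attraction.

End attraction.

(** * The transform R_k *)

Section Rdf_structure.
Context {R : realType}.
Implicit Types (k : nat) (p : R) (F : R -> R).

Lemma ler_ratio1D (x y : R) : 0 <= x -> x <= y -> x / (1 + x) <= y / (1 + y).
Proof.
move=> x0 xy; rewrite ler_pdivrMr ?ltr_wpDr//.
rewrite mulrAC ler_pdivlMr; last by lra.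
by lra.
Qed.

Lemma Rdf_id_ge0 k p : p <= 1 -> 0 <= Rdf k id p.
Proof.
rewrite /Rdf => p1; case: ifP => // p0.
have L0 : 0 <= - ln p by rewrite oppr_ge0 ln_le0.
rewrite subr_ge0 exprn_ile1 ?divr_ge0 ?addr_ge0//.
by rewrite ler_pdivrMr ?mul1r ?lerDr// ltr_wpDr.
Qed.

Lemma Rdf_id_nd k p q : p <= q -> q <= 1 -> Rdf k id p <= Rdf k id q.
Proof.
move=> pq q1; rewrite {1}/Rdf; case: ifP => p0; last exact: Rdf_id_ge0.
have q0 := lt_le_trans p0 pq.
rewrite /Rdf q0 lerD2l lerN2; apply: lerXn2r.
- by rewrite nnegrE divr_ge0 ?addr_ge0// oppr_ge0 ln_le0.
- by rewrite nnegrE divr_ge0 ?addr_ge0// oppr_ge0 ln_le0// (le_trans pq).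
- by apply: ler_ratio1D; rewrite ?oppr_ge0 ?ln_le0// lerN2 ler_ln.
Qed.

Lemma Rdf_id0 k : Rdf k id 0 = 0 :> R.
Proof. by rewrite /Rdf ltxx. Qed.

Lemma Rdf_id1 k : (0 < k)%N -> Rdf k id 1 = 1 :> R.
Proof. by move=> k0; rewrite /Rdf ltr01 ln1 oppr0 mul0r expr0n gtn_eqF// subr0. Qed.

Lemma Rdf_id_lt1 k p : (0 < k)%N -> 0 <= p <= 1 -> (Rdf k id p < 1) = (p < 1).
Proof.
move=> k0 /andP[p0 p1]; apply/idP/idP => [|pl1].
  by apply: contraTT; rewrite -!leNgt => p1'; rewrite (@le_anti _ _ p 1) ?p1// Rdf_id1.
rewrite /Rdf; case: ifP => [pgt|_]; last exact: ltr01.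
have L0 : 0 < - ln p by rewrite oppr_gt0 ln_lt0// pgt.
by rewrite ltrBlDr ltrDl exprn_gt0// divr_gt0// addr_gt0.
Qed.

(** The form [1 - 1 / (1 + L)] of the ratio gives its limit as [L] tends to infinity and is easier
    to differentiate. *)
Lemma onem_inv_ln p : 1 - ln p != 0 -> 1 - (1 - ln p)^-1 = - ln p / (1 - ln p).
Proof. by move=> p1; apply: (mulIf p1); rewrite divfK// mulrBl mulVf//; lra. Qed.

Lemma cvg_ln_at_right0 : - ln p @[p --> (0 : R)^'+] --> (+oo : set_system R).
Proof.
apply/cvgryPge => A; near=> p.
have p0 : 0 < p by near: p; exact: nbhs_right_gt.
rewrite lerNr -[X in _ <= X]expRK ler_ln ?posrE ?expR_gt0//.
by near: p; apply: nbhs_right_le; exact: expR_gt0.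
Unshelve. all: by end_near. Qed.

(** At 0 from the right [- ln z] tends to infinity, so the ratio tends to 1 and the transform to 0,
    the value assigned for [p <= 0]. For [0 < p <= 1] the denominator is at least 1. *)
Lemma Rdf_id_continuous k p : p <= 1 -> {for p, continuous (Rdf k (@id R))}.
Proof.
move=> p1; case: (ltgtP p 0) => p0.
- have Rle0 z : z <= 0 -> Rdf k id z = 0 by rewrite /Rdf ltNge => ->.
  suff : Rdf k id z @[z --> p] --> Rdf k id p by [].
  rewrite Rle0 ?ltW//; apply: cvg_near_cst; near=> z; rewrite Rle0// ltW//; near: z.
  exact: lt_nbhsl.
- have Lc : - ln z @[z --> p] --> - ln p by apply: cvgN; exact: continuous_ln.
  have : 1 - (- ln z / (1 - ln z)) ^+ k @[z --> p] --> 1 - (- ln p / (1 - ln p)) ^+ k.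
    apply: cvgB; first exact: cvg_cst.
    apply: cvg_exprn; apply: cvgM => //; apply: cvgV.
      by rewrite gt_eqF// ltr_wpDr// oppr_ge0 ln_le0.
    by apply: cvgD => //; exact: cvg_cst.
  have <- : Rdf k id p = 1 - (- ln p / (1 - ln p)) ^+ k by rewrite /Rdf p0.
  apply: cvg_trans; apply: near_eq_cvg; near=> z.
  by rewrite /Rdf ifT//; near: z; exact: lt_nbhsr.
- rewrite p0; apply/left_right_continuousP; rewrite Rdf_id0; split.
    apply: cvg_near_cst; near=> z; rewrite /Rdf ltNge ltW//; near: z.
  have Vc : (1 - ln z)^-1 @[z --> (0 : R)^'+] --> (0 : R).
    apply/gtr0_cvgV0.
      near=> z; rewrite ltr_wpDr// oppr_ge0 ln_le0//; near: z.
      exact: nbhs_right_le.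
    apply/cvgryPge => A; near=> z.
    apply: (@le_trans _ _ (- ln z)); last by rewrite lerDr.
    by near: z; exact: ((cvgryPge _).1 cvg_ln_at_right0).
  have : 1 - (1 - (1 - ln z)^-1) ^+ k @[z --> (0 : R)^'+] --> 1 - (1 - 0 : R) ^+ k.
    apply: cvgB; first exact: cvg_cst.
    by apply: cvg_exprn; apply: cvgB => //; exact: cvg_cst.
  rewrite subr0 expr1n subrr; apply: cvg_trans; apply: near_eq_cvg; near=> z.
  have z0 : 0 < z by near: z; exact: nbhs_right_gt.
  have z1 : 0 < 1 - ln z.
    by rewrite ltr_wpDr// oppr_ge0 ln_le0//; near: z; exact: nbhs_right_le.
  by rewrite /Rdf z0 -onem_inv_ln// lt0r_neq0.
Unshelve. all: by end_near. Qed.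

Lemma Rdf_id_cvg {T : Type} {D : set_system T} {FD : Filter D} k {u : T -> R}
    {p} : p <= 1 ->
  u x @[x --> D] --> p -> Rdf k id (u x) @[x --> D] --> Rdf k id p.
Proof. by move=> p1 up; apply: (cvg_comp _ _ up); exact: Rdf_id_continuous. Qed.

Lemma Rdf_is_df k F : (0 < k)%N -> is_df F -> is_df (Rdf k F).
Proof.
move=> k0 dfF; have F1 x : F x <= 1 by have /andP[] := df01 dfF x.
split.
- by move=> x y xy; apply: (Rdf_id_nd k (F x) (F y)); rewrite ?F1// df_nondecreasing.
- by move=> x; apply: Rdf_id_cvg => //; exact: df_right_continuous.
- by rewrite -(Rdf_id0 k); apply: Rdf_id_cvg => //; exact: df_cvgNy.
- by rewrite -(Rdf_id1 k k0); apply: Rdf_id_cvg => //; exact: df_cvgy.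
Qed.

Lemma Rdf_continuous k F : is_df F -> continuous F -> continuous (Rdf k F).
Proof.
move=> dfF Fc x; apply: Rdf_id_cvg; last exact: Fc.
by have /andP[] := df01 dfF x.
Qed.

Lemma Rdf_right_end k F : (0 < k)%N -> is_df F -> right_end (Rdf k F) = right_end F.
Proof.
move=> k0 dfF; rewrite /right_end; congr (ereal_sup (_ @` _)).
by apply/seteqP; split => x /=; rewrite Rdf_id Rdf_id_lt1//; exact: df01.
Qed.

Lemma Hdf_is_df k F : (0 < k)%N -> is_df F -> is_df (Hdf k F).
Proof.
move=> k0 dfF; have F01 := df01 dfF.
have Hc (T : Type) (D : set_system T) (FD : Filter D) (u : T -> R) (l : R) :
    u x @[x --> D] --> l -> 1 - (1 - u x) ^+ k @[x --> D] --> 1 - (1 - l) ^+ k.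
  move=> ul; apply: cvgB; first exact: cvg_cst.
  by apply: cvg_exprn; apply: cvgB => //; exact: cvg_cst.
split.
- move=> x y xy; rewrite lerD2l lerN2; apply: lerXn2r; rewrite ?nnegrE ?subr_ge0.
  + by have /andP[] := F01 y.
  + by have /andP[] := F01 x.
  + by rewrite lerD2l lerN2 (df_nondecreasing dfF).
- by move=> x; apply: Hc; exact: df_right_continuous.
- have -> : 0 = 1 - (1 - 0) ^+ k :> R by rewrite subr0 expr1n subrr.
  by apply: Hc; exact: df_cvgNy.
- have -> : 1 = 1 - (1 - 1) ^+ k :> R by rewrite subrr expr0n gtn_eqF// subr0.
  by apply: Hc; exact: df_cvgy.
Qed.

Lemma Hdf_right_end k F : (0 < k)%N -> is_df F -> right_end (Hdf k F) = right_end F.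
Proof.
move=> k0 dfF; rewrite /right_end; congr (ereal_sup (_ @` _)).
apply/seteqP; split => x /=; rewrite /Hdf ltrBlDr ltrDl => h.
  rewrite lt_neqAle; have /andP[_ ->] := df01 dfF x; rewrite andbT.
  by apply: contraTneq h => ->; rewrite subrr expr0n gtn_eqF// ltxx.
by rewrite exprn_gt0// subr_gt0.
Qed.

(** With [L = - ln F], the quotient is the [k]-th power of [(L / (1 - F)) / (1 + L)], where
    [L / (1 - F)] tends to 1 and [L] to 0. *)
Lemma Rdf_tail_cvg k F : is_df F -> continuous F ->
  (1 - Rdf k F x) / (1 - F x) ^+ k @[x --> left_nbhs (right_end F)] --> (1 : R).
Proof.
move=> dfF Fc; have c1 := cvg_left_end dfF Fc.
have lt1 := near_left_end_lt1 dfF.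
have F1 x : F x <= 1 by have /andP[] := df01 dfF x.
have p0 : \forall x \near left_nbhs (right_end F), 0 < F x.
  exact: (cvgr_gt _ c1).
have wL : (1 - F x)^-1 * (- ln (F x)) @[x --> left_nbhs (right_end F)] --> (1 : R).
  have w0 : \forall x \near left_nbhs (right_end F), 0 <= (1 - F x)^-1.
    by near=> x; rewrite invr_ge0 subr_ge0.
  apply/(cvg_near1_ln w0 _ c1); first by near=> x.
  apply: cvg_near_cst; near=> x.
  by rewrite mulVf// subr_eq0 eq_sym lt_eqF//; near: x.
have Lc : 1 - ln (F x) @[x --> left_nbhs (right_end F)] --> (1 : R).
  rewrite -[X in _ --> X]subr0 -ln1; apply: cvgB; first exact: cvg_cst.
  by apply: continuous_cvg => //; exact: continuous_ln.
have : ((1 - F x)^-1 * (- ln (F x)) * (1 - ln (F x))^-1) ^+ k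
    @[x --> left_nbhs (right_end F)] --> (1 * (1 : R)^-1) ^+ k.
  by apply: cvg_exprn; apply: cvgM => //; exact: cvgV.
rewrite invr1 mulr1 expr1n; apply: cvg_trans; apply: near_eq_cvg; near=> x.
rewrite /Rdf ifT; last by near: x.
by rewrite opprB addrCA subrr addr0 -expr_div_n; congr (_ ^+ _); rewrite -mulrA mulrC.
Unshelve. all: by end_near. Qed.

End Rdf_structure.

(** * From local increments to a global identity *)

Section increments.
Context {R : realType}.

(** Differentiability as an increment bound that also covers [y = x], so that it can be composed
    with an [F] that is constant on intervals. *)
Lemma is_derive_increment (g : R -> R) (x l : R) : is_derive x 1 g l ->
  forall e, 0 < e -> \forall y \near x, `|g y - g x - l * (y - x)| <= e * `|y - x|.
Proof.
move=> [dg <-] e e0.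
have /cvgrPdist_le/(_ _ e0) := dg.
rewrite /dnbhs /within /= => /nbhs_ballP[d /= d0 hd].
exists d => //= y; rewrite /ball_ /= => yx.
have [->|neq] := eqVneq y x; first by rewrite !subrr mulr0 subrr normr0 mulr0.
have yx0 : y - x != 0 by rewrite subr_eq0.
have := hd (y - x); rewrite /ball /= sub0r opprB => /(_ yx yx0).
rewrite /shift /= -[X in X + x]/((y - x) * 1) mulr1 subrK => h.
rewrite -[_ - _ - _](divfK yx0) normrM; apply: ler_wpM2r => //.
rewrite distrC in h; apply: le_trans h; rewrite le_eqVlt; apply/orP; left; apply/eqP.
by congr `|_|; rewrite mulrBl mulfK// [_^-1 *: _]mulrC.
Qed.

(* Real induction on the set of points up to which the bound holds. *)
Lemma increment_eq0 (D F : R -> R) (s t : R) : nondecreasing F -> s <= t ->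
    (forall c e, s <= c -> c <= t -> 0 < e -> \forall y \near c, s <= y -> y <= t ->
      `|D y - D c| <= e * `|F y - F c|) ->
  D t = D s.
Proof.
move=> Fnd st loc.
suff bnd e : 0 < e -> `|D t - D s| <= e * (F t - F s).
  apply/eqP; rewrite -subr_eq0 -normr_le0; apply/ler_addgt0Pl => e e0.
  rewrite addr0; have Fts : 0 <= F t - F s by rewrite subr_ge0 Fnd.
  have F1 : 0 < F t - F s + 1 by rewrite ltr_wpDl.
  have := bnd (e / (F t - F s + 1)); rewrite divr_gt0// => /(_ isT).
  move=> /le_trans; apply; rewrite mulrAC ler_pdivrMr//.
  by rewrite ler_pM2l// lerDl.
move=> e0; pose S := [set y | s <= y <= t /\ `|D y - D s| <= e * (F y - F s)].
have Ss : S s by split; rewrite ?lexx// !subrr normr0 mulr0.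
have ubS : ubound S t by move=> y [/andP[]].
have supS : has_sup S by split; [exists s|exists t].
pose c := sup S.
have sc : s <= c by apply: ub_le_sup => //; exists t.
have ct : c <= t by apply: ge_sup => //; exists s.
have /nbhs_ballP[d /= d0 hd] := loc c e sc ct e0.
have Sc : S c.
  have [y [/andP[sy yt] Dy] yc] := sup_adherent d0 supS.
  have yc' : y <= c by apply: ub_le_sup; [exists t|split => //; apply/andP].
  split; first by rewrite sc ct.
  have : `|D y - D c| <= e * `|F y - F c|.
    apply: hd => //; rewrite /ball /= ger0_norm ?subr_ge0//.
    by move: yc; rewrite -/c; lra.
  have := Fnd _ _ yc'; rewrite -subr_le0 => /ler0_norm ->.
  rewrite -[D c - D s](subrKA (D y)) distrC => h.
  by apply: le_trans (ler_normD _ _) _; move: h Dy; rewrite distrC; lra.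
have [ctE|] := eqVneq c t; first by move: Sc => []; rewrite ctE.
rewrite neq_lt ltNge [t < c]ltNge ct orbF => /negP c_ne.
have c_lt : c < t by rewrite lt_neqAle ct andbT; apply/eqP => h; apply: c_ne; rewrite h.
(* If [c < t], this point lies beyond [c] within distance [d], and it belongs to [S], contrary to
   [c = sup S]. *)
pose y := Num.min t (c + d / 2).
have cy : c < y by rewrite lt_min c_lt ltrDl divr_gt0.
have yt : y <= t by rewrite ge_min lexx.
have sy : s <= y by rewrite (le_trans sc)// ltW.
have ycd : y - c < d.
  have : y <= c + d / 2 by rewrite ge_min lexx orbT.
  lra.
suff : S y by move/(ub_le_sup (ex_intro _ t ubS)); rewrite leNgt cy.
split; first by rewrite sy yt.
have : `|D y - D c| <= e * `|F y - F c|.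
  by apply: hd => //; rewrite /ball /= distrC gtr0_norm ?subr_gt0.
have := Fnd _ _ (ltW cy); rewrite -subr_ge0 => /ger0_norm -> h.
move: Sc => [_ hc]; rewrite -[D y - D s](subrKA (D c)).
by apply: le_trans (ler_normD _ _) _; move: h hc; lra.
Qed.

End increments.

(** * The derivative of the transform *)

Section Rdf_density.
Context {R : realType} (k : nat).
Hypothesis k_gt0 : (0 < k)%N.
Implicit Types p : R.

(** The derivative of [Rdf k id] at [0 < p <= 1]; where [F x > 0], [Rpdf k F f x] is its value at
    [F x] times [f x]. *)
Definition Rdf_deriv p : R :=
  k%:R * (- ln p) ^+ k.-1 / (p * (1 - ln p) ^+ k.+1).

Lemma Rdf_deriv_ge0 p : 0 < p <= 1 -> 0 <= Rdf_deriv p.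
Proof.
move=> /andP[p0 p1]; have L0 : 0 <= - ln p by rewrite oppr_ge0 ln_le0.
by rewrite divr_ge0// mulr_ge0 ?exprn_ge0 ?(ltW p0)// addr_ge0.
Qed.

(** The power of [- ln p] is dominated by that of [1 - ln p], which leaves [k / p]. The bound makes
    the integral of the density finite away from [F = 0]. *)
Lemma Rdf_deriv_le p q : 0 < q -> q <= p -> p <= 1 -> Rdf_deriv p <= k%:R / q.
Proof.
move=> q0 qp p1; have p0 := lt_le_trans q0 qp.
have L0 : 0 <= - ln p by rewrite oppr_ge0 ln_le0.
have L1 : 0 < 1 - ln p by rewrite ltr_wpDr.
rewrite /Rdf_deriv -mulrA ler_wpM2l// invfM mulrCA.
apply: (@le_trans _ _ (p^-1 * 1)); last by rewrite mulr1 lef_pV2.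
rewrite ler_wpM2l ?invr_ge0 ?(ltW p0)// ler_pdivrMr ?exprn_gt0// mul1r.
apply: (@le_trans _ _ ((1 - ln p) ^+ k.-1)).
  by rewrite lerXn2r ?nnegrE ?(ltW L1)// lerDr.
by rewrite ler_weXn2l ?lerDl//; lia.
Qed.

Lemma Rdf_deriv_continuous p : 0 < p <= 1 -> {for p, continuous Rdf_deriv}.
Proof.
move=> /andP[p0 p1]; have L0 : 0 <= - ln p by rewrite oppr_ge0 ln_le0.
have L1 : 0 < 1 - ln p by rewrite ltr_wpDr.
have lnc : - ln z @[z --> p] --> - ln p by apply: cvgN; exact: continuous_ln.
apply: cvgM.
  by apply: cvgM; [exact: cvg_cst|exact: cvg_exprn].
apply: cvgV; first by rewrite mulf_neq0 ?expf_neq0 ?gt_eqF.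
apply: cvgM; first exact: cvg_id.
by apply: cvg_exprn; apply: cvgD => //; exact: cvg_cst.
Qed.

Lemma Rdf_is_derive p : 0 < p <= 1 -> is_derive p 1 (Rdf k (@id R)) (Rdf_deriv p).
Proof.
move=> /andP[p0 p1]; have L0 : 0 <= - ln p by rewrite oppr_ge0 ln_le0.
have L1 : 0 < 1 - ln p by rewrite ltr_wpDr.
have h1 : is_derive p 1 (cst 1 - @ln R) (0 - p^-1).
  by apply: is_deriveB; exact: is_derive1_ln.
have h2 := is_deriveV (lt0r_neq0 L1 : (cst 1 - @ln R) p != 0) h1.
have h3 := is_deriveX k (is_deriveB (is_derive_cst (1 : R) p 1) h2).
have h4 := is_deriveB (is_derive_cst (1 : R) p 1) h3.
apply: (near_eq_is_derive _ (is_derive_eq h4 _)).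
  near=> z; have z0 : 0 < z by near: z; exact: lt_nbhsr.
  have z1 : 1 - ln z != 0.
    (* At [p = 1] the nearby [z] may exceed 1; [z < expR 1] keeps [1 - ln z] nonzero. *)
    rewrite subr_eq0 eq_sym lt_eqF// -(expRK 1) ltr_ln ?posrE ?expR_gt0//.
    by near: z; apply: lt_nbhsl; apply: (le_lt_trans p1); rewrite expR_gt1.
  by rewrite /Rdf z0 /=; congr (_ - _); rewrite fctE -(onem_inv_ln _ z1).
change (0 - (k%:R * (1 - (1 - ln p)^-1) ^+ k.-1)
  * (0 - - ((1 - ln p) ^+ 2)^-1 * (0 - p^-1)) = Rdf_deriv p).
rewrite (onem_inv_ln _ (lt0r_neq0 L1)) expr_div_n /Rdf_deriv.
have -> : k.+1 = (k.-1 + 2)%N by rewrite addn2 prednK.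
rewrite exprD; have := expf_neq0 k.-1 (lt0r_neq0 L1); have := lt0r_neq0 L1.
have := lt0r_neq0 p0.
move: (_ ^+ k.-1) ((1 - ln p) ^+ k.-1) (1 - ln p) => A B C p_neq0 C0 B0.
field; exact/and3P.
Unshelve. all: by end_near. Qed.

End Rdf_density.

(** * The density of [R_k] *)

Section Rdf_pdf.
Context {R : realType} {F f : R -> R} (k : nat).
Hypothesis k_gt0 : (0 < k)%N.
Hypothesis dfF : is_df F.
Hypothesis pdfF : has_pdf F f.

Let mu := @lebesgue_measure R.
Let F01 := df01 dfF.
Let Fnd := df_nondecreasing dfF.
Let Fc := pdf_continuous dfF pdfF.
Let phi := Rdf k (@id R).
Let r := Rpdf k F f.

Let f_ge0 x : 0 <= f x. Proof. by case: pdfF. Qed.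

Let rE x : 0 < F x -> r x = Rdf_deriv k (F x) * f x.
Proof. by move=> Fx; rewrite /r /Rpdf Fx /Rdf_deriv [RHS]mulrAC (mulrAC k%:R). Qed.

Let r0 x : F x <= 0 -> r x = 0.
Proof. by rewrite /r /Rpdf ltNge => ->. Qed.

Let r_ge0 x : 0 <= r x.
Proof.
have [Fx|Fx] := ltP 0 (F x); last by rewrite r0.
rewrite rE// mulr_ge0// Rdf_deriv_ge0// Fx.
by have /andP[] := F01 x.
Qed.

Let mf (D : set R) : measurable_fun D f.
Proof. by apply: measurable_funTS; case: pdfF. Qed.

Lemma Rpdf_measurable : measurable_fun [set: R] r.
Proof.
have mF : measurable_fun [set: R] F by exact: continuous_measurable_fun.
rewrite [r](_ : _ = fun x => if 0 < F x then Rdf_deriv k (F x) * f x else 0); last first.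
  by apply/funext => x; case: ifPn => [/rE//|]; rewrite -leNgt => /r0.
have oF : open [set x | 0 < F x].
  have -> : [set x | 0 < F x] = F @^-1` `]0, +oo[.
    by apply/seteqP; split => x /=; rewrite in_itv /= andbT.
  by apply: open_comp => // x _; exact: Fc.
apply: measurable_fun_if => //.
- exact: measurable_fun_ltr.
rewrite setTI (_ : _ @^-1` _ = [set x | 0 < F x]); last by [].
apply: measurable_funM; last exact: mf.
apply: open_continuous_measurable_fun => // x; rewrite inE /= => Fx.
suff : Rdf_deriv k (F y) @[y --> x] --> Rdf_deriv k (F x) by [].
apply: (cvg_comp F (Rdf_deriv k) (Fc x)).
apply: Rdf_deriv_continuous; rewrite Fx.
by have /andP[] := F01 x.
Qed.

Let mr (D : set R) : measurable_fun D (fun t => (r t)%:E).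
Proof. by apply/measurable_EFinP; apply: measurable_funTS; exact: Rpdf_measurable. Qed.

Let mfE (D : set R) : measurable_fun D (fun t => (f t)%:E).
Proof. exact/measurable_EFinP. Qed.

Let I x y := (\int[mu]_(t in `]x, y]) (r t)%:E)%E.

Let I_ge0 x y : (0 <= I x y)%E.
Proof. by apply: integral_ge0 => t _; rewrite lee_fin. Qed.

Let I_add x y z : x <= y -> y <= z -> I x z = (I x y + I y z)%E.
Proof.
move=> xy yz; rewrite /I.
have -> : [set` `]x, z]] = [set` `]x, y]] `|` [set` `]y, z]] :> set R.
  apply/seteqP; split => t /=; rewrite !in_itv /=.
    by move=> /andP[xt tz]; case: (leP t y) => ty; [left; rewrite xt|right].
  by case=> /andP[h1 h2]; apply/andP; split; lra.
rewrite ge0_integral_setU//; first exact: mr.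
  by move=> t _; rewrite lee_fin.
apply/eqP; rewrite -subset0 => t /= []; rewrite !in_itv /= => /andP[_ ty] /andP[yt _].
by move: ty; rewrite leNgt yt.
Qed.

Let I_le x y M : 0 <= M -> x <= y -> 0 < F x ->
    (forall t, x <= t -> t <= y -> Rdf_deriv k (F t) <= M) ->
  (I x y <= (M * (F y - F x))%:E)%E.
Proof.
move=> M0 xy Fx hM; rewrite EFinM -(integral_pdf pdfF _ _ xy) -ge0_integralZl//; last 2 first.
- exact: mfE.
- by move=> t _; rewrite lee_fin.
apply: ge0_le_integral => //.
- by move=> t _; rewrite lee_fin.
- exact: mr.
- apply: measurable_funeM; exact: mfE.
move=> t /=; rewrite in_itv /= => /andP[xt ty].
have Ft : 0 < F t by apply: (lt_le_trans Fx); apply: Fnd; exact: ltW.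
by rewrite -EFinM lee_fin rE// ler_wpM2r// hM// ltW.
Qed.

Let I_ge x y M : x <= y -> 0 < F x ->
    (forall t, x <= t -> t <= y -> M <= Rdf_deriv k (F t)) ->
  ((M * (F y - F x))%:E <= I x y)%E.
Proof.
move=> xy Fx hM; have [M0|M0] := ltP M 0.
  apply: le_trans (I_ge0 _ _); rewrite lee_fin nmulr_rle0// subr_ge0.
  exact: Fnd.
rewrite EFinM -(integral_pdf pdfF _ _ xy) -ge0_integralZl//; last 2 first.
- exact: mfE.
- by move=> t _; rewrite lee_fin.
apply: ge0_le_integral => //.
- by move=> t _; rewrite -EFinM lee_fin mulr_ge0.
- apply: measurable_funeM; exact: mfE.
- exact: mr.
move=> t /=; rewrite in_itv /= => /andP[xt ty].
have Ft : 0 < F t by apply: (lt_le_trans Fx); apply: Fnd; exact: ltW.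
by rewrite -EFinM lee_fin rE// ler_wpM2r// hM// ltW.
Qed.

Let I_fin x y : 0 < F x -> x <= y -> I x y \is a fin_num.
Proof.
move=> Fx xy; rewrite ge0_fin_numE//.
apply: (@le_lt_trans _ _ (k%:R / F x * (F y - F x))%:E); last by rewrite ltry.
apply: I_le => // [|t xt ty]; first by rewrite divr_ge0// ltW.
apply: Rdf_deriv_le => //; first exact: Fnd.
by have /andP[] := F01 t.
Qed.

(** Near [c] the factor [Rdf_deriv k (F t)] is within [e] of its value at [c], so the integral is
    that value times the increment of [F], up to [e] times this increment. *)
Let I_local c e : 0 < F c -> 0 < e -> \forall y \near c,
  (c <= y -> `|fine (I c y) - Rdf_deriv k (F c) * (F y - F c)| <= e * `|F y - F c|) /\
  (y <= c -> 0 < F y ->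
    `|fine (I y c) - Rdf_deriv k (F c) * (F c - F y)| <= e * `|F y - F c|).
Proof.
move=> Fc0 e0; set m := Rdf_deriv k (F c).
have gc : Rdf_deriv k (F y) @[y --> c] --> m.
  apply: (cvg_comp F (Rdf_deriv k) (Fc c)); apply: Rdf_deriv_continuous; rewrite Fc0.
  by have /andP[] := F01 c.
have /cvgrPdist_le/(_ _ e0)/nbhs_ballP[d /= d0 hd] := gc.
have fin_bounds x y : 0 < F x -> x <= y ->
    (forall t, x <= t -> t <= y -> `|m - Rdf_deriv k (F t)| <= e) ->
    `|fine (I x y) - m * (F y - F x)| <= e * (F y - F x).
  move=> Fx xy hm.
  have m0 : 0 <= m + e.
    rewrite addr_ge0 ?(ltW e0)// Rdf_deriv_ge0// Fc0.
    by have /andP[] := F01 c.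
  have := I_le _ _ _ m0 xy Fx; have := I_ge _ _ (m - e) xy Fx.
  rewrite -(fineK (I_fin _ _ Fx xy)) !lee_fin => h1 h2.
  have {}h1 : (m - e) * (F y - F x) <= fine (I x y).
    by apply: h1 => t xt ty; have := hm t xt ty; rewrite ler_distlC => /andP[].
  have {}h2 : fine (I x y) <= (m + e) * (F y - F x).
    by apply: h2 => t xt ty; have := hm t xt ty; rewrite ler_distlC => /andP[].
  by rewrite ler_norml; apply/andP; split; lra.
exists d => //= y; rewrite /ball_ /= => cy; split=> [c_le|le_c Fy].
  have Fcy := Fnd _ _ c_le.
  rewrite [X in _ <= _ * X]ger0_norm ?subr_ge0//; apply: fin_bounds => // t ct ty.
  apply: hd; rewrite /ball /=; move: cy.
  by rewrite !ler0_norm ?subr_le0//; lra.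
have Fyc := Fnd _ _ le_c.
rewrite [X in _ <= _ * X]ler0_norm ?subr_le0// opprB; apply: fin_bounds => // t yt tc.
apply: hd; rewrite /ball /=; move: cy.
by rewrite !ger0_norm ?subr_ge0//; lra.
Qed.

(** Both the integral and [phi (F x)] have increments equal to [Rdf_deriv k (F c)] times that of
    [F], up to a small multiple of it, so their difference is constant. Comparison with [F] replaces
    differentiation in [x], where [F] can fail to be differentiable. *)
Let I_phi s t : 0 < F s -> s <= t -> I s t = (phi (F t) - phi (F s))%:E.
Proof.
move=> Fs st; pose D x := fine (I s x) - phi (F x).
have Iss : I s s = 0%E by rewrite /I set_itvoc0 integral_set0.
suff : D t = D s.
  rewrite /D Iss /= sub0r -(fineK (I_fin _ _ Fs st)) => h; congr EFin.
  by move: h; lra.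
apply: (increment_eq0 D F) => // c e sc ct e0.
have Fc0 : 0 < F c by apply: lt_le_trans Fs _; exact: Fnd.
have e2 : 0 < e / 2 by rewrite divr_gt0.
have dphi : is_derive (F c) 1 phi (Rdf_deriv k (F c)).
  by apply: Rdf_is_derive => //; rewrite Fc0; have /andP[] := F01 c.
have h1 : \forall y \near c,
    `|phi (F y) - phi (F c) - Rdf_deriv k (F c) * (F y - F c)| <= e / 2 * `|F y - F c|.
  exact: (Fc c _ (is_derive_increment _ _ _ dphi _ e2)).
apply: filterS2 h1 (I_local _ _ Fc0 e2) => y h1 [h2 h3] sy yt.
have [cy|yc] := leP c y.
  have -> : D y - D c = fine (I c y) - Rdf_deriv k (F c) * (F y - F c)
      - (phi (F y) - phi (F c) - Rdf_deriv k (F c) * (F y - F c)).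
    rewrite /D (I_add _ _ _ sc cy) (fineD (I_fin _ _ Fs sc) (I_fin _ _ Fc0 cy)); lra.
  apply: le_trans (ler_normB _ _) _; have := h2 cy; move: h1; lra.
have {}yc := ltW yc.
have Fy : 0 < F y by apply: lt_le_trans Fs _; exact: Fnd.
have -> : D y - D c = - (fine (I y c) - Rdf_deriv k (F c) * (F c - F y))
    - (phi (F y) - phi (F c) - Rdf_deriv k (F c) * (F y - F c)).
  rewrite /D (I_add _ _ _ sy yc) (fineD (I_fin _ _ Fs sy) (I_fin _ _ Fy yc)); lra.
apply: le_trans (ler_normB _ _) _; rewrite normrN; have := h3 yc Fy; move: h1; lra.
Qed.

(** The identity [I_phi] starts at an [s] with [F s > 0]. Letting [F (s n)] decrease to 0 exhausts
    the part of []-oo, x]] where [F > 0], outside which the density is 0, and [phi (F (s n))] tends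
    to 0. *)
Lemma Rdf_has_pdf : has_pdf (Rdf k F) (Rpdf k F f).
Proof.
split; [exact: Rpdf_measurable|exact: r_ge0|move=> x].
have [Fx|Fx] := ltP 0 (F x); last first.
  rewrite /Rdf ltNge Fx /= integral0_eq// => t /=; rewrite in_itv /= => tx.
  by rewrite -/(r t) r0// (le_trans _ Fx)// Fnd.
(* Dividing by at least 2 puts the level strictly between 0 and 1, even when [F x = 1]. *)
pose s n := quantile F (F x / n.+2%:R).
have Fx1 : F x <= 1 by have /andP[] := F01 x.
have Fs n : F (s n) = F x / n.+2%:R.
  apply: (quantileK dfF Fc); rewrite divr_gt0//= ltr_pdivrMr// mul1r.
  by apply: le_lt_trans Fx1 _; rewrite ltr1n.
have Fs_gt0 n : 0 < F (s n) by rewrite Fs divr_gt0.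
have s_le n : s n <= x.
  rewrite leNgt; apply/negP => /ltW/Fnd; rewrite Fs ler_pdivlMr// leNgt.
  by rewrite ltr_pMr// ltr1n.
have s_homo m n : (m <= n)%N -> s n <= s m.
  rewrite leq_eqVlt => /predU1P[->//|mn]; rewrite leNgt; apply/negP => /ltW/Fnd.
  by rewrite !Fs leNgt ltr_pM2l// ltf_pV2 ?posrE// ltr_nat 2!ltnS mn.
have Fs0 : F (s n) @[n --> \oo] --> (0 : R).
  rewrite -(mulr0 (F x)); under eq_fun do rewrite Fs.
  apply: cvgM; first exact: cvg_cst.
  by rewrite (cvg_shiftS (fun n : nat => n.+1%:R^-1 : R)); exact: cvg_harmonic.
pose A := \bigcup_n [set` `]s n, x]].
have AE : A = [set` `]-oo, x]] `&` [set t | 0 < F t].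
  apply/seteqP; split => t /=.
    move=> [n _ /=]; rewrite !in_itv /= => /andP[st tx]; split => //.
    by apply: lt_le_trans (Fs_gt0 n) _; apply: Fnd; exact: ltW.
  rewrite in_itv /= => -[tx Ft].
  have [n Fn] := filter_ex (cvgr_lt _ Fs0 _ Ft).
  exists n => //=; rewrite in_itv /= tx andbT ltNge; apply/negP => /Fnd.
  by rewrite leNgt Fn.
have mA : measurable A by apply: bigcup_measurable.
have -> : (\int[mu]_(t in `]-oo, x]) (r t)%:E = \int[mu]_(t in A) (r t)%:E)%E.
  have -> : [set` `]-oo, x]] = A `|` ([set` `]-oo, x]] `\` A) :> set R.
    by rewrite setDUK// AE; exact: subIsetl.
  rewrite ge0_integral_setU//.
  - rewrite [X in (_ + X)%E]integral0_eq ?adde0// => t /= [tx nA].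
    by rewrite r0// leNgt; apply/negP => Ft; apply: nA; rewrite AE.
  - exact: measurableD.
  - exact: mr.
  - by move=> t _; rewrite lee_fin.
  - by apply/eqP; rewrite -subset0 => t [? []].
have c1 : I (s n) x @[n --> \oo] --> (\int[mu]_(t in A) (r t)%:E)%E.
  apply: ge0_nondecreasing_set_cvg_integral => //.
  - move=> m n mn; apply/subsetPset => t /=; rewrite !in_itv /= => /andP[st ->].
    by rewrite andbT (le_lt_trans _ st)// s_homo.
  - by move=> n; exact: mr.
  - by move=> n t _; rewrite lee_fin.
have c2 : I (s n) x @[n --> \oo] --> (phi (F x))%:E.
  under eq_fun do rewrite I_phi//.
  apply: cvg_EFin; first by near=> n.
  rewrite /comp /= -[X in _ --> X]subr0 -[X in _ --> _ - X](Rdf_id0 (R := R) k).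
  by apply: cvgB; [exact: cvg_cst|exact: Rdf_id_cvg].
by rewrite Rdf_id -/phi; apply: (cvg_unique _ c2 c1).
Unshelve. all: by end_near. Qed.

End Rdf_pdf.

(** * Norming constants of R_k *)

Lemma Dl_law {R : realType} {F G : R -> R} : continuous G -> Dl F G ->
  exists a b, (forall n, 0 < a n) /\
    forall x, F (a n * x + b n) ^+ n @[n --> \oo] --> G x.
Proof.
by move=> Gc [a [b [a0 FG]]]; exists a, b; split => // x; apply: FG; exact: Gc.
Qed.

(** Since [Dl] asks for positive constants at every index, the value 1 replaces the finitely many
    that are not positive. *)
Lemma converges_normed_Dl {R : realType} {F G : R -> R} {a b : nat -> R} :
  converges_normed F G a b -> Dl F G.
Proof.
move=> [a0 FG]; exists (fun n => if 0 < a n then a n else 1), b; split.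
  by move=> n; case: ifP.
move=> x _; apply: cvg_trans _ (FG x); apply: near_eq_cvg; near=> n.
by rewrite ifT//; near: n.
Unshelve. all: by end_near. Qed.

Lemma cvg_affine_arg {R : realType} {A B a b : nat -> R} {al be : R} (x : R) :
    (forall n, 0 < a n) ->
    A n / a n @[n --> \oo] --> al -> (B n - b n) / a n @[n --> \oo] --> be ->
  (A n * x + B n - b n) / a n @[n --> \oo] --> al * x + be.
Proof.
move=> a0 cA cB.
have : A n / a n * x + (B n - b n) / a n @[n --> \oo] --> al * x + be.
  by apply: cvgD => //; apply: cvgM => //; exact: cvg_cst.
apply: cvg_trans; apply: near_eq_cvg; near=> n.
by rewrite -addrA (mulrDl (A n * x)) mulrAC.
Unshelve. all: by end_near. Qed.

Section norming.
Context {R : realType} {F : R -> R} (k : nat).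
Hypothesis k_gt0 : (0 < k)%N.
Hypothesis dfF : is_df F.
Hypothesis F_cont : continuous F.

(** The index at which the constants of [F] are used: its [k]-th power is asymptotic to [n]. *)
Let m (n : nat) : nat := Num.truncn (kroot k n : R).

Let m_cvgy : m n @[n --> \oo] --> \oo.
Proof. by apply: truncn_cvgny; exact: kroot_cvgy. Qed.

Let m_ratio : (m n)%:R / (kroot k n : R) @[n --> \oo] --> (1 : R).
Proof. by apply: truncn_ratio_cvg; exact: kroot_cvgy. Qed.

Let F01 := df01 dfF.
Let Fnd := df_nondecreasing dfF.

Let qF (n : nat) : R := quantile F (1 - (1 / n%:R) `^ (1 / k%:R)).

Let qR (n : nat) : R := quantile (Rdf k F) (1 - 1 / n%:R).

(** Continuity makes [1 - F (qF n)] equal to [1 / kroot k n] for large [n], and [m n / kroot k n]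
    tends to 1. *)
Let quantile_pow : F (qF n) ^+ m n @[n --> \oo] --> expR (- 1).
Proof.
apply: cvg_tail_pow => //; first by move=> n; have /andP[] := F01 (qF n).
apply: cvg_trans _ m_ratio; apply: near_eq_cvg.
have sy := kroot_cvgy (R := R) k k_gt0.
near=> n; have s1 : 1 < kroot k n :> R by near: n; exact: (cvgry_gt sy).
rewrite /qF (_ : (1 / n%:R) `^ (1 / k%:R) = (kroot k n)^-1 :> R); last first.
  by rewrite !div1r -powR_inv1// -powRrM mulN1r powRN.
have s0 := lt_trans ltr01 s1.
rewrite (quantileK dfF F_cont) ?subKr//.
by rewrite subr_gt0 ltrBlDr ltrDl invr_gt0 s0 invf_lt1// s1.
Unshelve. all: by end_near. Qed.

(** With [s = kroot k n] and [L = - ln (F (qR n))], the equation [(L / (1 + L)) ^ k = 1 / n] solves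
    to [L = 1 / (s - 1)], so [m n * L] tends to 1. *)
Let Rdf_quantile_pow : F (qR n) ^+ m n @[n --> \oo] --> expR (- 1).
Proof.
have sy := kroot_cvgy (R := R) k k_gt0.
have qE : \forall n \near \oo, 0 < F (qR n) /\ - ln (F (qR n)) = (kroot k n - 1)^-1.
  near=> n; have n1 : (1 < n)%N by near: n; exact: nbhs_infty_gt.
  have s1 : 1 < kroot k n :> R by near: n; exact: (cvgry_gt sy).
  have s0 := lt_trans ltr01 s1.
  have n0 : 0 < n%:R :> R by rewrite ltr0n ltnW.
  have : Rdf k F (qR n) = 1 - 1 / n%:R.
    apply: quantileK; [exact: Rdf_is_df|exact: Rdf_continuous|].
    by rewrite subr_gt0 ltrBlDr ltrDl div1r invr_gt0 n0 invf_lt1// ltr1n n1.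
  (* The branch [F = 0] would make the quantile level 0, that is [n = 1]. *)
  rewrite {1}/Rdf; case: ifP => [Fq|_]; last first.
    move=> /esym/eqP; rewrite subr_eq0 eq_sym div1r invr_eq1 pnatr_eq1 => /eqP n1E.
    by rewrite n1E in n1.
  move=> /(addrI 1)/oppr_inj; rewrite div1r -(krootX k n k_gt0) -exprVn => /eqP.
  have L0 : 0 <= - ln (F (qR n)).
    by rewrite oppr_ge0 ln_le0//; have /andP[] := F01 (qR n).
  have L1 : 0 < 1 - ln (F (qR n)) by rewrite ltr_wpDr.
  rewrite eqrXn2 ?divr_ge0 ?invr_ge0 ?(ltW L1) ?(ltW s0)// => /eqP h; split=> //.
  move: (- ln _) h L0 L1 => L h L0 L1.
  have s10 : kroot k n - 1 != 0 :> R by rewrite subr_eq0 gt_eqF.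
  apply: (mulIf s10); rewrite mulVf//.
  have /(congr1 (fun z => z * (1 + L) * kroot k n)) := h.
  rewrite divfK ?gt_eqF// mulrAC mulVf ?gt_eqF// mul1r; lra.
have h : expR (- ((m n)%:R / kroot k n * (kroot k n / (kroot k n - 1)))) @[n --> \oo]
    --> expR (- (1 * (1 : R))).
  apply: continuous_cvg; first exact: continuous_expR.
  apply: cvgN; apply: cvgM => //.
  have h1 : 1 + (kroot k n - 1)^-1 @[n --> \oo] --> (1 + 0 : R).
    apply: cvgD; first exact: cvg_cst.
    apply/gtr0_cvgV0.
      by near=> n; rewrite subr_gt0; near: n; exact: (cvgry_gt sy).
    apply/cvgryPge => A; near=> n; rewrite lerBrDr; near: n.
    exact: ((cvgryPge _).1 sy).
  rewrite addr0 in h1; apply: cvg_trans _ h1; apply: near_eq_cvg; near=> n.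
  have s10 : kroot k n - 1 != 0 :> R.
    by rewrite subr_eq0 gt_eqF//; near: n; exact: (cvgry_gt sy).
  by apply: (mulIf s10); rewrite divfK// mulrDl mulVf// mul1r subrK.
rewrite mulr1 in h; apply: cvg_trans _ h; apply: near_eq_cvg; near=> n.
have s0 : kroot k n != 0 :> R by rewrite gt_eqF//; near: n; exact: (cvgry_gt sy).
have [Fq qn] : 0 < F (qR n) /\ - ln (F (qR n)) = (kroot k n - 1)^-1 by near: n.
by rewrite mulrA divfK// -qn mulrN opprK mulr_natl -lnXn// lnK// posrE exprn_gt0.
Unshelve. all: by end_near. Qed.

Section law.
Context {G : R -> R} {a b : nat -> R}.
Hypothesis G_cont : continuous G.
Hypothesis a_gt0 : forall n, 0 < a n.
Hypothesis FG : forall x, F (a n * x + b n) ^+ n @[n --> \oo] --> G x.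

Let Rdf_law (u : nat -> R) x : 0 < G x ->
    (u n - b (m n)) / a (m n) @[n --> \oo] --> x ->
  Rdf k F (u n) ^+ n @[n --> \oo] --> expR (- (- ln (G x)) ^+ k).
Proof.
move=> Gx cu.
have := law_cvg_pow F G a b Fnd F01 a_gt0 FG m_cvgy (G_cont x) cu.
exact: (Rdf_pow_cvg k_gt0 m_cvgy m_ratio (fun n => F01 (u n))).
Qed.

Lemma Rdf_normed_law {A B : nat -> R} {al be x : R} : 0 < G (al * x + be) ->
    A n / a (m n) @[n --> \oo] --> al ->
    (B n - b (m n)) / a (m n) @[n --> \oo] --> be ->
  Rdf k F (A n * x + B n) ^+ n @[n --> \oo]
    --> expR (- (- ln (G (al * x + be))) ^+ k).
Proof. by move=> Gx cA cB; apply: Rdf_law => //; exact: cvg_affine_arg. Qed.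

(** The powers at the quantiles tend to [expR (- 1)], so the point [x0] where [G] takes this value
    is their limiting argument. *)
Lemma quantile_arg x0 : G x0 = expR (- 1) -> (forall y, y < x0 -> G y < G x0) ->
    (forall y, x0 < y -> G x0 < G y) ->
  (qF n - b (m n)) / a (m n) @[n --> \oo] --> x0.
Proof.
move=> Gx0 Gl Gr; apply: (law_cvg_arg F G a b Fnd F01 a_gt0 FG m_cvgy) => //.
by rewrite Gx0; exact: quantile_pow.
Qed.

End law.

Lemma near_gt0_ratio (A a : nat -> R) : (forall n, 0 < a n) ->
  A n / a n @[n --> \oo] --> (1 : R) -> \forall n \near \oo, 0 < A n.
Proof.
move=> a0 cA; have : \forall n \near \oo, 0 < A n / a n by exact: (cvgr_gt _ cA).
by apply: filterS => n; rewrite pmulr_lgt0// invr_gt0.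
Qed.

Lemma Frechet_normed alpha : 0 < alpha -> Dl F (Frechet alpha) ->
  (forall y, F y < 1) /\
  converges_normed (Rdf k F) (Frechet (k%:R * alpha))
    (fun n => quantile F (1 - (1 / n%:R) `^ (1 / k%:R))) (fun=> 0).
Proof.
move=> a0 /(Dl_law (Frechet_continuous alpha a0))[a [b [a_gt0 FG]]].
have ka : 0 < k%:R * alpha by rewrite mulr_gt0// ltr0n.
split.
  move=> y; apply: (Frechet_lt1 Fnd F01 a_gt0 alpha a0 FG).
  exact: df_right_continuous.
have bc : b (m n) / a (m n) @[n --> \oo] --> (0 : R).
  exact: (cvg_comp m (fun n => b n / a n) m_cvgy
    (Frechet_centering Fnd F01 a_gt0 alpha a0 FG)).
have Bc : (0 - b (m n)) / a (m n) @[n --> \oo] --> (0 : R).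
  have : - (b (m n) / a (m n)) @[n --> \oo] --> - (0 : R) by exact: cvgN.
  rewrite oppr0; apply: cvg_trans; apply: near_eq_cvg.
  by near=> n; rewrite sub0r mulNr.
(* The value [Frechet alpha 1 = expR (- 1)] puts the quantiles at argument 1, and the centering [b]
   is negligible. *)
have Ac : qF n / a (m n) @[n --> \oo] --> (1 : R).
  have G1 : Frechet alpha 1 = expR (- 1) by rewrite FrechetE// powR1.
  have h := quantile_arg a_gt0 FG 1 G1 (fun y => lt_Frechet _ _ _ a0 ltr01)
    (fun y h => lt_Frechet _ _ _ a0 (lt_trans ltr01 h) h).
  have : (qF n - b (m n)) / a (m n)
      + b (m n) / a (m n) @[n --> \oo] --> (1 + 0 : R) by exact: cvgD.
  rewrite addr0; apply: cvg_trans; apply: near_eq_cvg.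
  by near=> n; rewrite -mulrDl subrK.
split; first exact: (near_gt0_ratio _ _ (fun n => a_gt0 (m n)) Ac).
have pos x : 0 < x -> Rdf k F (qF n * x + 0) ^+ n
    @[n --> \oo] --> Frechet (k%:R * alpha) x.
  move=> x0; have := Rdf_normed_law (Frechet_continuous alpha a0) a_gt0 FG _ Ac Bc (x := x).
  by rewrite mul1r addr0 Frechet_pow//; apply; rewrite FrechetE// expR_gt0.
move=> x; have [x0|x0] := ltP 0 x; first exact: pos.
(* For [x <= 0] the law is 0, out of reach of the logarithm: the powers are bounded by those at a
   small [y > 0], whose limit is below [e]. *)
rewrite FrechetN//; apply/cvgrPdist_le => e e0.
have : \forall y \near (0 : R)^'+, 0 < y /\ Frechet (k%:R * alpha) y < e.
  apply: filterI; first exact: nbhs_right_gt.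
  have := Frechet_continuous _ ka 0.
  rewrite /continuous_at FrechetN// => /cvg_at_right_filter h.
  exact: (cvgr_lt _ h).
move=> /filter_ex[y [y0 ye]].
have A0 := near_gt0_ratio _ _ (fun n => a_gt0 (m n)) Ac.
have lte : \forall n \near \oo,
    Rdf k F (qF n * y + 0) ^+ n < e.
  exact: (cvgr_lt _ (pos y y0)).
apply: filterS2 A0 lte => n A0 lte.
have R0 z : 0 <= Rdf k F z by have /andP[] := df01 (Rdf_is_df k F k_gt0 dfF) z.
rewrite sub0r normrN ger0_norm; last by rewrite exprn_ge0 ?R0.
apply: le_trans (ltW lte); apply: lerXn2r; rewrite ?nnegrE ?R0//.
apply: (df_nondecreasing (Rdf_is_df k F k_gt0 dfF)).
by rewrite lerD2r ler_pM2l// (le_trans x0)// ltW.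
Unshelve. all: by end_near. Qed.

Lemma Weibull_normed alpha : 0 < alpha -> Dl F (Weibull alpha) ->
  (right_end F < +oo)%E /\
  converges_normed (Rdf k F) (Weibull (k%:R * alpha))
    (fun n => fine (right_end F) - quantile F (1 - (1 / n%:R) `^ (1 / k%:R)))
    (fun=> fine (right_end F)).
Proof.
move=> a0 /(Dl_law (Weibull_continuous alpha a0))[a [b [a_gt0 FG]]].
have [roo rc] := Weibull_right_end Fnd F01 a_gt0 alpha a0 FG.
split; [exact: roo|set r := fine (right_end F) in rc *].
have Bc : (r - b (m n)) / a (m n) @[n --> \oo] --> (0 : R).
  exact: (cvg_comp m (fun n => (r - b n) / a n) m_cvgy rc).
have N1 : -1 < 0 :> R by rewrite ltrN10.
have GN1 : Weibull alpha (-1) = expR (- 1).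
  by rewrite WeibullE// normrN1 powR1.
(* The value [Weibull alpha (-1) = expR (- 1)] puts the quantiles at argument -1, hence about
   [a (m n)] below the endpoint. *)
have Ac : (r - qF n) / a (m n) @[n --> \oo] --> (1 : R).
  have h := quantile_arg a_gt0 FG (-1) GN1
    (fun y h => lt_Weibull _ _ _ a0 (lt_trans h N1) h)
    (fun y h => lt_Weibull _ _ _ a0 N1 h).
  have : (r - b (m n)) / a (m n)
      - (qF n - b (m n)) / a (m n)
      @[n --> \oo] --> (0 - -1 : R) by exact: cvgB.
  rewrite opprK add0r; apply: cvg_trans; apply: near_eq_cvg.
  by near=> n; rewrite -mulrBl; congr (_ / _); lra.
split; first exact: (near_gt0_ratio _ _ (fun n => a_gt0 (m n)) Ac).
move=> x.
have := Rdf_normed_law (Weibull_continuous alpha a0) a_gt0 FG _ Ac Bc (x := x).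
by rewrite mul1r addr0 Weibull_pow//; apply; exact: Weibull_gt0.
Unshelve. all: by end_near. Qed.

Lemma Gumbel_normed (v : R -> R) : Dl F Gumbel ->
    (forall x, 0 <= x ->
      (1 - F (t + v t * x)) / (1 - F t)
        @[t --> left_nbhs (right_end F)] --> expR (- x)) ->
    let beta n := quantile F (1 - 1 / n%:R) in
    let b n := quantile (Rdf k F) (1 - 1 / n%:R) in
  converges_normed F Gumbel (fun n => v (beta n)) beta /\
  converges_normed (Rdf k F) Gumbel (fun n => v (b n) / k%:R) b.
Proof.
move=> /(Dl_law Gumbel_continuous)[a [d [a_gt0 FG]]] vF beta b.
have G0 : Gumbel 0 = expR (- 1) :> R by rewrite /Gumbel oppr0 expR0.
have arg (u : nat -> R) (mm : nat -> nat) x : mm n @[n --> \oo] --> \oo ->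
    F (u n) ^+ mm n @[n --> \oo] --> Gumbel x ->
    (u n - d (mm n)) / a (mm n) @[n --> \oo] --> x.
  move=> cm; apply: (law_cvg_arg F Gumbel a d Fnd F01 a_gt0 FG cm) => y; exact: lt_Gumbel.
(* The tail condition at 1 gives [F (t n + v (t n)) ^ mm n --> Gumbel 1], so the arguments of [t n]
   and [t n + v (t n)] tend to 0 and 1; their difference is [v (t n) / a (mm n)]. *)
have scale (t : nat -> R) (mm : nat -> nat) : mm n @[n --> \oo] --> \oo ->
    F (t n) ^+ mm n @[n --> \oo] --> expR (- 1) ->
    ((t n - d (mm n)) / a (mm n) @[n --> \oo] --> (0 : R)) /\
    (v (t n) / a (mm n) @[n --> \oo] --> (1 : R)).
  move=> cm ct; have c0 : (t n - d (mm n)) / a (mm n) @[n --> \oo] --> (0 : R).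
    by apply: arg => //; rewrite G0.
  split => //.
  have [t1 tail] := cvg_pow_tail cm (fun n => F01 (t n)) (expR_gt0 _) ct.
  rewrite expRK opprK in tail.
  have tlt1 : \forall n \near \oo, F (t n) < 1.
    have : \forall n \near \oo, 0 < (mm n)%:R * (1 - F (t n)) by exact: (cvgr_gt _ tail).
    apply: filterS => n h; rewrite ltNge; apply/negP => F1; move: h.
    by rewrite ltNge mulr_ge0_le0// subr_le0.
  have tl := cvg_to_left_end dfF t t1 tlt1.
  have h1 : (1 - F (t n + v (t n) * 1)) / (1 - F (t n)) @[n --> \oo] --> expR (- 1).
    exact: (cvg_comp t (fun t => (1 - F (t + v t * 1)) / (1 - F t)) tl (vF 1 ler01)).
  have h2 : (mm n)%:R * (1 - F (t n + v (t n))) @[n --> \oo] --> expR (- 1).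
    have : (mm n)%:R * (1 - F (t n)) * ((1 - F (t n + v (t n) * 1)) / (1 - F (t n)))
        @[n --> \oo] --> 1 * expR (- 1) by exact: cvgM.
    rewrite mul1r; apply: cvg_trans; apply: near_eq_cvg; near=> n.
    rewrite mulr1 -mulrA; congr (_ * _); rewrite mulrC divfK//.
    by rewrite subr_eq0 gt_eqF//; near: n.
  have h3 : F (t n + v (t n)) ^+ mm n @[n --> \oo] --> Gumbel 1.
    apply: cvg_tail_pow => // n; by have /andP[] := F01 (t n + v (t n)).
  have h4 := arg _ _ _ cm h3.
  have : (t n + v (t n) - d (mm n)) / a (mm n) - (t n - d (mm n)) / a (mm n)
      @[n --> \oo] --> (1 - 0 : R) by exact: cvgB.
  rewrite subr0; apply: cvg_trans; apply: near_eq_cvg; near=> n.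
  by rewrite -mulrBl; congr (_ / _); lra.
split.
- have cb : F (beta n) ^+ n @[n --> \oo] --> expR (- 1).
    apply: (cvg_tail_pow cvg_id) => [n|]; first by have /andP[] := F01 (beta n).
    apply: cvg_near_cst; near=> n.
    have n1 : (1 < n)%N by near: n; exact: nbhs_infty_gt.
    have n0 : 0 < n%:R :> R by rewrite ltr0n ltnW.
    rewrite /beta (quantileK dfF F_cont).
      by rewrite opprB addrCA subrr addr0 div1r divff// gt_eqF.
    by rewrite subr_gt0 ltrBlDr ltrDl div1r invr_gt0 n0 invf_lt1// ltr1n n1.
  have [c0 c1] := scale _ _ cvg_id cb.
  split; first exact: (near_gt0_ratio _ _ a_gt0 c1).
  move=> x; apply: (law_cvg_pow F Gumbel a d Fnd F01 a_gt0 FG cvg_id).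
    exact: Gumbel_continuous.
  have := cvg_affine_arg x a_gt0 c1 c0.
  by rewrite mul1r addr0.
have [c0 c1] := scale _ _ m_cvgy Rdf_quantile_pow.
have kr : 0 < k%:R :> R by rewrite ltr0n.
(* The slope [1 / k] cancels the factor [k] produced by [Gumbel_pow]. *)
have Ac : v (b n) / k%:R / a (m n) @[n --> \oo] --> (k%:R^-1 : R).
  have : v (b n) / a (m n) * k%:R^-1 @[n --> \oo] --> (1 * k%:R^-1 : R).
    by apply: cvgM => //; exact: cvg_cst.
  rewrite mul1r; apply: cvg_trans; apply: near_eq_cvg.
  by near=> n; rewrite mulrAC.
split.
  apply: filterS (near_gt0_ratio _ _ (fun n => a_gt0 (m n)) c1) => n.
  by move=> v0; rewrite divr_gt0.
move=> x; have := Rdf_normed_law Gumbel_continuous a_gt0 FG _ Ac c0 (x := x).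
rewrite addr0 Gumbel_pow mulrA divff ?gt_eqF// mul1r; apply.
exact: expR_gt0.
Unshelve. all: by end_near. Qed.

End norming.

(** * The distribution [R_k], its tail and its domains of attraction *)

Theorem theorem4p3 (R : realType) (F f : R -> R) (k : nat)
    (dfF : is_df F) (pdfF : has_pdf F f) (k_gt0 : (0 < k)%N) :
  (* (a) *)
  [/\ is_df (Rdf k F), has_pdf (Rdf k F) (Rpdf k F f),
      right_end (Rdf k F) = right_end F,
      (1 - Rdf k F x) / (1 - F x) ^+ k
        @[x --> left_nbhs (right_end F)] --> (1 : R) &
      tail_equivalent (Rdf k F) (Hdf k F)]
  /\
  (* (b) *)
  (forall alpha : R, 0 < alpha -> Dl F (Frechet alpha) ->
    [/\ right_end (Rdf k F) = right_end F, right_end F = +oo%E,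
        Dl (Rdf k F) (Frechet (k%:R * alpha)) &
        converges_normed (Rdf k F) (Frechet (k%:R * alpha))
          (fun n => quantile F (1 - (1 / n%:R) `^ (1 / k%:R)))
          (fun=> 0)])
  /\
  (* (c) *)
  (forall alpha : R, 0 < alpha -> Dl F (Weibull alpha) ->
    [/\ right_end (Rdf k F) = right_end F, (right_end F < +oo)%E,
        Dl (Rdf k F) (Weibull (k%:R * alpha)) &
        converges_normed (Rdf k F) (Weibull (k%:R * alpha))
          (fun n => fine (right_end F)
                    - quantile F (1 - (1 / n%:R) `^ (1 / k%:R)))
          (fun=> fine (right_end F))])
  /\
  (* (d) *)
  (forall v : R -> R, Dl F Gumbel ->
    (forall t, (t%:E < right_end F)%E -> 0 < v t) ->
    (forall x, 0 <= x ->
      (1 - F (t + v t * x)) / (1 - F t)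
        @[t --> left_nbhs (right_end F)] --> expR (- x)) ->
    let beta n := quantile F (1 - 1 / n%:R) in
    let b n := quantile (Rdf k F) (1 - 1 / n%:R) in
    [/\ converges_normed F Gumbel (fun n => v (beta n)) beta,
        right_end (Rdf k F) = right_end F,
        Dl (Rdf k F) Gumbel &
        converges_normed (Rdf k F) Gumbel (fun n => v (b n) / k%:R) b]).
Proof.
have Fc := pdf_continuous dfF pdfF.
have Re := Rdf_right_end k F k_gt0 dfF.
have Rd := Rdf_is_df k F k_gt0 dfF.
have tail := Rdf_tail_cvg k F dfF Fc.
split; [split=> //; first exact: Rdf_has_pdf|split; [|split]].
- split=> //; first exact: Hdf_is_df.
    by rewrite Re Hdf_right_end.
  (* Here [1 - Hdf k F] is exactly [(1 - F) ^ k], so the limit 1 of the tail quotient carries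
     over. *)
  exists 1 => //; rewrite Re; apply: cvg_trans _ tail; apply: near_eq_cvg.
  by near=> x; rewrite /Hdf opprB addrCA subrr addr0.
- move=> alpha a0 FG; have [F1 cn] := Frechet_normed k k_gt0 dfF Fc alpha a0 FG.
  split; [exact: Re| |exact: converges_normed_Dl cn|exact: cn].
  have [[]//|[r _ h]] := df_right_endP dfF.
  by have := h r; rewrite F1 ltxx.
- move=> alpha a0 FG; have [r1 cn] := Weibull_normed k k_gt0 dfF Fc alpha a0 FG.
  by split; [exact: Re|exact: r1|exact: converges_normed_Dl cn|exact: cn].
- move=> v FG v0 vF beta b.
  have [c1 c2] := Gumbel_normed k k_gt0 dfF Fc v FG vF.
  by split; [exact: c1|exact: Re|exact: converges_normed_Dl c2|exact: c2].
Unshelve. all: by end_near. Qed.
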